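(* Every (discrete-time) subproduct system of two-dimensional complex Hilbert spaces is isomorphic to one and only one of the subproduct systems $\mathcal E_1(a)$ ($a\in[0,1)$), $\mathcal E_2(a)$ ($a\in[0,1)$), $\mathcal E_3(\lambda)$ ($\lambda\in\mathbb{C}\setminus\{0\}$), $\mathcal E_4$, $\mathcal E_5$.
   Context: A (discrete-time) subproduct system consists of two-dimensional complex Hilbert spaces $E_t$ for $t\in\{1,2,\dots\}$ and isometric linear maps $\beta_{s,t}:E_{s+t}\to E_s\otimes E_t$ for $s,t\in\{1,2,\dots\}$ satisfying $(\beta_{r,s}\otimes\mathbf 1_t)\beta_{r+s,t}=(\mathbf 1_r\otimes\beta_{s,t})\beta_{r,s+t}$ for all $r,s,t\in\{1,2,\dots\}$, where $\mathbf 1_t$ is the identity map of $E_t$. An isomorphism between subproduct systems $(E_t,\beta_{s,t})$ and $(F_t,\gamma_{s,t})$ consists of unitary operators $\theta_t:E_t\to F_t$, $t=1,2,\dots$, such that $\gamma_{s,t}\theta_{s+t}=(\theta_s\otimes\theta_t)\beta_{s,t}$ for all $s,t\in\{1,2,\dots\}$. A family of vectors $x_t,y_t\in E_t$ ($t=1,2,\dots$) is called a basis of the indicated type if for all $s,t\in\{1,2,\dots\}$ the following holds. Type $\mathcal E_1(a)$, $a\in[0,1)$: $\|x_t\|=\|y_t\|=1$, $\langle x_t,y_t\rangle=a^t$, $\beta_{s,t}(x_{s+t})=x_s\otimes x_t$, $\beta_{s,t}(y_{s+t})=y_s\otimes y_t$. Type $\mathcal E_2(a)$, $a\in[0,1)$: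 $\|x_t\|=\|y_t\|=1$, $\langle x_t,y_t\rangle=a^t$; if $s$ is even, $\beta_{s,t}(x_{s+t})=x_s\otimes x_t$ and $\beta_{s,t}(y_{s+t})=y_s\otimes y_t$; if $s$ is odd, $\beta_{s,t}(x_{s+t})=x_s\otimes y_t$ and $\beta_{s,t}(y_{s+t})=y_s\otimes x_t$. Type $\mathcal E_3(\lambda)$, $\lambda\in\mathbb{C}\setminus\{0\}$: $\|x_t\|=1$, $\|y_t\|^2=1+|\lambda|^2+\dots+|\lambda|^{2t-2}$, $\langle x_t,y_t\rangle=0$, $\beta_{s,t}(x_{s+t})=x_s\otimes x_t$, $\beta_{s,t}(y_{s+t})=y_s\otimes x_t+\lambda^s x_s\otimes y_t$. Type $\mathcal E_4$: $\|x_t\|=\|y_t\|=1$, $\langle x_t,y_t\rangle=0$, $\beta_{s,t}(x_{s+t})=x_s\otimes x_t$, $\beta_{s,t}(y_{s+t})=y_s\otimes x_t$. Type $\mathcal E_5$: $\|x_t\|=\|y_t\|=1$, $\langle x_t,y_t\rangle=0$, $\beta_{s,t}(x_{s+t})=x_s\otimes x_t$, $\beta_{s,t}(y_{s+t})=x_s\otimes y_t$. For each type, subproduct systems having a basis of that type (with the given value of the parameter, if any) exist and are mutually isomorphic; the symbols $\mathcal E_1(a),\mathcal E_2(a),\mathcal E_3(\lambda),\mathcal E_4,\mathcal E_5$ denote the corresponding subproduct systems, defined up to isomorphism. *)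

(* Defs.v *)
From HB Require Import structures.
From mathcomp Require Import all_boot all_order all_algebra.
From mathcomp Require Import sesquilinear.
From mathcomp Require Import boolp.

Set Implicit Arguments.
Unset Strict Implicit.
Unset Printing Implicit Defensive.

Import Order.TTheory GRing.Theory Num.Theory Num.Def.
Local Open Scope ring_scope.

(* Completeness is automatic: the underlying space is finite dimensional.     *)
Record hilbert (C : numClosedFieldType) := Hilbert {
  hspace :> vectType C;
  hdot : {dot hspace for conjC}
}.

Notation "''[' u , v ]" := (hdot _ u v) (format "''[' u ,  v ]") : ring_scope.

Section HilbertTheory.
Variable C : numClosedFieldType.
Implicit Types V W X : hilbert C.

Definition hnorm V (v : V) : C := sqrtC '[v, v].

Lemma orthonormalize V (s : seq V) : free s ->
  exists t : seq V, [/\ size t = size s, <<t>>%VS = <<s>>%VS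
                      & orthonormal (hdot V) t].
Proof.
elim: s => [|b s IHs]; first by exists [::].
rewrite free_cons => /andP[bNs /IHs[t [szt spant ont]]].
have [X tX [Y [bXY _ oYt]]] := orthogonal_split (hdot V) t b.
have Y0 : Y != 0.
  apply: contra bNs => /eqP Y0; by rewrite bXY Y0 addr0 -spant.
have n0 : 0 < '[Y, Y] by rewrite dnorm_gt0.
pose Z := (sqrtC '[Y, Y])^-1 *: Y.
have s0 : (sqrtC '[Y, Y]) != 0 by rewrite sqrtC_eq0 gt_eqF.
exists (Z :: t); split; first by rewrite /= szt.
  rewrite !span_cons -spant.
  have -> : <[Z]>%VS = <[Y]>%VS.
    apply/eqP; rewrite eqEsubv -!memvE memvZ ?memv_line //=.
    by rewrite -[Y in Y \in _](scalerKV s0) memvZ ?memv_line.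
  apply/eqP; rewrite eqEsubv !subv_add !addvSr !andbT -!memvE.
  apply/andP; split.
    rewrite -[Y](addKr X) -bXY addrC memv_add ?memv_line //.
    by rewrite memvN.
  by rewrite bXY addrC memv_add ?memv_line.
rewrite -cat1s orthonormal_cat ont /=.
apply/andP; split.
  rewrite /orthonormal /= !andbT.
  rewrite linearZr_LR /= linearZl_LR /=.
  rewrite fmorphV /= (CrealP _) ?rpredV; last first.
    by rewrite realE sqrtC_ge0 ltW.
  by rewrite mulrA -invfM -expr2 sqrtCK mulVf // gt_eqF.
rewrite andbT; apply/allP => psi psit /=.
by rewrite linearZl_LR /= (orthoPl oYt _ psit) mulr0.
Qed.

Lemma onb_ex V : exists b : (\dim {: V}).-tuple V,
  basis_of fullv b && orthonormal (hdot V) b.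
Proof.
have /andP[/eqP spanb freeb] := vbasisP {: V}.
have [t [szt spant ont]] := orthonormalize freeb.
have szt' : size t == \dim {: V} by rewrite szt size_tuple.
exists (Tuple szt'); rewrite ont andbT.
by rewrite /basis_of /= spant spanb eqxx (orthonormal_free ont).
Qed.

Definition onb V : (\dim {: V}).-tuple V := xchoose (onb_ex V).

Local Notation "''b_' i" := (tnth (onb _) i)
  (at level 8, i at level 2, format "''b_' i").

Lemma onb_basis V : basis_of fullv (onb V).
Proof. by have /andP[] := xchooseP (onb_ex V). Qed.

Lemma onb_orthonormal V : orthonormal (hdot V) (onb V).
Proof. by have /andP[] := xchooseP (onb_ex V). Qed.

Lemma onb_dot V i j : '['b_i : V, 'b_j] = (i == j)%:R.
Proof.
have /orthonormalP[u ->] := onb_orthonormal V; rewrite ?mem_tnth //.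
by rewrite !(tnth_nth 0) nth_uniq ?size_tuple.
Qed.

Lemma onb_decomp V (v : V) : v = \sum_i '[v, 'b_i] *: 'b_i.
Proof.
have vb : v \in <<onb V>>%VS.
  by have /andP[/eqP-> _] := onb_basis V; rewrite memvf.
rewrite [LHS](coord_span vb); apply: eq_bigr => i _.
rewrite -tnth_nth; congr (_ *: _).
rewrite {2}(coord_span vb) linear_sumlz /= (bigD1 i) //= big1 ?addr0.
  by rewrite -tnth_nth linearZl_LR /= onb_dot eqxx mulr1.
move=> j ji; rewrite -tnth_nth linearZl_LR /= onb_dot (negPf ji) mulr0 //.
Qed.

Definition mxdot m n (A B : 'M[C]_(m, n)) : C :=
  \sum_i \sum_j A i j * (B i j)^*.

Lemma mxdot_bilinear m n :
  bilinear_for (GRing.Scale.Law.clone _ _ *%R _)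
    (GRing.Scale.Law.clone _ _ (conjC \; *%R) _) (@mxdot m n).
Proof.
split=> [B|B] a A A'; rewrite /mxdot /= mulr_sumr -big_split /=;
  apply: eq_bigr => i _; rewrite mulr_sumr -big_split /=;
  apply: eq_bigr => j _; rewrite !mxE ?rmorphD ?rmorphM /=.
- by rewrite mulrDl mulrA.
- by rewrite mulrDr mulrCA.
Qed.

HB.instance Definition _ m n :=
  bilinear_isBilinear.Build C 'M[C]_(m, n) 'M[C]_(m, n) C _ _ (@mxdot m n)
    (mxdot_bilinear m n).

Lemma mxdot_herm m n (A B : 'M[C]_(m, n)) :
  mxdot A B = (-1) ^+ false * (mxdot B A)^*.
Proof.
rewrite mul1r /mxdot rmorph_sum; apply: eq_bigr => i _.
rewrite rmorph_sum; apply: eq_bigr => j _.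
by rewrite rmorphM /= conjCK mulrC.
Qed.

HB.instance Definition _ m n :=
  isHermitianSesquilinear.Build C 'M[C]_(m, n) false conjC (@mxdot m n)
    (@mxdot_herm m n).

Lemma mxdot_gt0 m n (A : 'M[C]_(m, n)) : A != 0 -> 0 < mxdot A A.
Proof.
have ge0 i : 0 <= \sum_j A i j * (A i j)^*.
  by apply: sumr_ge0 => j _; exact: mul_conjC_ge0.
move=> A0; rewrite lt_def sumr_ge0 // andbT.
apply: contra A0 => /eqP/psumr_eq0P H; apply/eqP/matrixP => i j.
have /psumr_eq0P H' : \sum_j A i j * (A i j)^* = 0 by apply: H.
apply/eqP; rewrite mxE -[_ == _]mul_conjC_eq0; apply/eqP; apply: H' => // k _.
exact: mul_conjC_ge0.
Qed.

HB.instance Definition _ m n :=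
  isDotProduct.Build C 'M[C]_(m, n) (@mxdot m n) (@mxdot_gt0 m n).

(* Coordinates are taken with respect to the products of the vectors of the   *)
(* chosen orthonormal bases; tens_dot and tens_lift_pure below characterize   *)
(* the result independently of this choice.                                   *)
Definition tens V W : hilbert C :=
  @Hilbert C 'M[C]_(\dim {: V}, \dim {: W}) (@mxdot _ _).

Definition pure V W (v : V) (w : W) : tens V W :=
  \matrix_(i, j) ('[v, 'b_i] * '[w, 'b_j]).

Lemma parseval V (v v' : V) :
  '[v, v'] = \sum_i '[v, 'b_i] * '[v', 'b_i]^*.
Proof.
rewrite {1}(onb_decomp v') linear_sumr /=; apply: eq_bigr => i _.
by rewrite linearZr_LR /= mulrC.
Qed.

Lemma tens_dot V W (v v' : V) (w w' : W) :
  '[pure v w, pure v' w'] = '[v, v'] * '[w, w'].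
Proof.
rewrite [LHS]/(mxdot _ _) [in RHS]parseval (parseval w) mulr_suml.
apply: eq_bigr => i _; rewrite mulr_sumr; apply: eq_bigr => j _.
by rewrite !mxE rmorphM mulrACA.
Qed.

Lemma pureDl V W (v v' : V) (w : W) : pure (v + v') w = pure v w + pure v' w.
Proof. by apply/matrixP => i j; rewrite !mxE linearDl mulrDl. Qed.
Lemma pureDr V W (v : V) (w w' : W) : pure v (w + w') = pure v w + pure v w'.
Proof. by apply/matrixP => i j; rewrite !mxE linearDl mulrDr. Qed.
Lemma pureZl V W a (v : V) (w : W) : pure (a *: v) w = a *: pure v w.
Proof. by apply/matrixP => i j; rewrite !mxE linearZl_LR mulrA. Qed.
Lemma pureZr V W a (v : V) (w : W) : pure v (a *: w) = a *: pure v w.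
Proof. by apply/matrixP => i j; rewrite !mxE linearZl_LR mulrCA. Qed.

Definition tens_lift_fun V W X (phi : V -> W -> X) (A : tens V W) : X :=
  \sum_i \sum_j (A : 'M_(_, _)) i j *: phi 'b_i 'b_j.

Lemma tens_lift_linear V W X (phi : V -> W -> X) : linear (tens_lift_fun phi).
Proof.
move=> a A B; rewrite /tens_lift_fun scaler_sumr -big_split /=.
apply: eq_bigr => i _; rewrite scaler_sumr -big_split /=.
by apply: eq_bigr => j _; rewrite !mxE scalerDl scalerA.
Qed.

HB.instance Definition _ V W X (phi : V -> W -> X) :=
  GRing.isLinear.Build C (tens V W) X _ (tens_lift_fun phi)
    (tens_lift_linear phi).

Definition tens_lift V W X (phi : V -> W -> X) : 'Hom(tens V W, X) :=
  linfun (tens_lift_fun phi).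

Lemma tens_liftE V W X (phi : V -> W -> X) A :
  tens_lift phi A = tens_lift_fun phi A.
Proof. by rewrite /tens_lift lfunE. Qed.

Lemma tens_lift_pure V W X (phi : V -> W -> X) :
  (forall w, linear (phi^~ w)) -> (forall v, linear (phi v)) ->
  forall v w, tens_lift phi (pure v w) = phi v w.
Proof.
move=> linl linr v w; rewrite tens_liftE /tens_lift_fun.
pose fl w := GRing.isLinear.Build C V X _ (phi^~ w) (linl w).
pose Fl w : {linear V -> X} := HB.pack (phi^~ w) (fl w).
pose fr v := GRing.isLinear.Build C W X _ (phi v) (linr v).
pose Fr v : {linear W -> X} := HB.pack (phi v) (fr v).
rewrite -[RHS]/(Fl w v) {2}(onb_decomp v) linear_sum.
apply: eq_bigr => i _; rewrite linearZ /= -[phi _ w]/(Fr 'b_i w).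
rewrite {2}(onb_decomp w) linear_sum scaler_sumr.
by apply: eq_bigr => j _; rewrite linearZ /= mxE scalerA.
Qed.

Definition tens_map V V' W W' (f : 'Hom(V, V')) (g : 'Hom(W, W')) :
    'Hom(tens V W, tens V' W') :=
  tens_lift (fun v w => pure (f v) (g w)).

Definition tens_assoc V W X : 'Hom(tens (tens V W) X, tens V (tens W X)) :=
  tens_lift (fun (A : tens V W) x =>
    tens_lift (fun v w => pure v (pure w x)) A).

Lemma tens_map_pure V V' W W' (f : 'Hom(V, V')) (g : 'Hom(W, W')) v w :
  tens_map f g (pure v w) = pure (f v) (g w).
Proof.
rewrite /tens_map tens_lift_pure //.
- by move=> w' a u u' /=; rewrite linearP pureDl pureZl.
- by move=> v' a u u' /=; rewrite linearP pureDr pureZr.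
Qed.

Lemma tens_assoc_pure V W X (v : V) (w : W) (x : X) :
  tens_assoc V W X (pure (pure v w) x) = pure v (pure w x).
Proof.
rewrite /tens_assoc tens_lift_pure.
- rewrite tens_lift_pure //.
  + by move=> w' a u u' /=; rewrite pureDl pureZl.
  + by move=> w' a u u' /=; rewrite pureDl pureZl pureDr pureZr.
- by move=> w' a u u' /=; rewrite linearP.
- move=> A a u u' ; rewrite !tens_liftE /tens_lift_fun /=.
  rewrite scaler_sumr -big_split; apply: eq_bigr => i _ /=.
  rewrite scaler_sumr -big_split; apply: eq_bigr => j _ /=.
  by rewrite !pureDr !pureZr scalerDr !scalerA [_ * a]mulrC.
Qed.

End HilbertTheory.

Notation "v \ox w" := (pure v w) (at level 40, left associativity) : ring_scope.

(* The fiber at 0 and the maps beta s t with s = 0 or t = 0 are junk: nothing *)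
(* is required of them, and they are ignored by isomorphic below.             *)
Record subproduct_system (C : numClosedFieldType) := SubproductSystem {
  fiber :> nat -> hilbert C;
  beta : forall s t, 'Hom(fiber (s + t), tens (fiber s) (fiber t));
  fiber_dim : forall t, (0 < t)%N -> \dim {: fiber t} = 2%N;
  beta_isometry : forall s t, (0 < s)%N -> (0 < t)%N ->
    forall u v, '[beta s t u, beta s t v] = '[u, v];
  beta_coassoc : forall r s t, (0 < r)%N -> (0 < s)%N -> (0 < t)%N ->
    forall u : fiber (r + (s + t)),
      tens_assoc _ _ _ (tens_map (beta r s) \1%VF
        (beta (r + s) t (ecast n (fiber n) (addnA r s t) u))) =
      tens_map \1%VF (beta s t) (beta r (s + t) u)
}.

Arguments beta {C} s0 s t.

Definition unitary (C : numClosedFieldType) (V W : hilbert C)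
    (f : 'Hom(V, W)) : Prop :=
  (forall u v, '[f u, f v] = '[u, v]) /\ bijective f.

Definition isomorphic (C : numClosedFieldType) (E F : subproduct_system C) :
    Prop :=
  exists theta : forall t, 'Hom(E t, F t),
    (forall t, (0 < t)%N -> unitary (theta t)) /\
    (forall s t, (0 < s)%N -> (0 < t)%N ->
       (beta F s t \o theta (s + t)%N)%VF =
       (tens_map (theta s) (theta t) \o beta E s t)%VF).

(* Every type is realized with all fibers equal to C^2: x t = (1, 0) and      *)
(* y t = (c t, sqrt (p t - c t ^ 2)), where c t = <x t, y t> and              *)
(* p t = |y t| ^ 2.                                                           *)
Section Model.
Variable C : numClosedFieldType.

Lemma hdot_comb (V : hilbert C) a b a' b' (u v u' v' : V) :
  '[a *: u + b *: v, a' *: u' + b' *: v'] =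
  a * (a'^* * '[u, u']) + a * (b'^* * '[u, v']) +
  (b * (a'^* * '[v, u']) + b * (b'^* * '[v, v'])).
Proof.
by rewrite linearDl !linearDr /= !linearZl_LR /= !linearZr_LR.
Qed.

Lemma hom_comb (V W : hilbert C) (f : 'Hom(V, W)) a b (u v : V) :
  f (a *: u + b *: v) = a *: f u + b *: f v.
Proof. by rewrite linearP linearZ. Qed.

Definition plane : hilbert C := @Hilbert C 'rV[C]_2 (@mxdot C 1 2).

Definition plane_vec (c d : C) : plane := \row_j (if j == 0 then c else d).

Lemma plane_dot c d c' d' :
  '[plane_vec c d, plane_vec c' d'] = c * c'^* + d * d'^*.
Proof.
by rewrite [LHS]/(mxdot _ _) big_ord1 !big_ord_recl big_ord0 !mxE /= addr0.
Qed.

Lemma plane_decomp c d (u : plane) : d != 0 ->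
  exists a b, u = a *: plane_vec 1 0 + b *: plane_vec c d.
Proof.
move=> d0; pose b := (u : 'rV_2) 0 1 / d.
exists ((u : 'rV_2) 0 0 - b * c), b; apply/rowP => j; rewrite !mxE.
case: j => [[|[|//]]] lj; rewrite -?[Ordinal lj]/(0 : 'I_2) /=.
  by rewrite mulr1 subrK; congr (u 0 _); apply: val_inj.
by rewrite mulr0 add0r divfK //; congr (u 0 _); apply: val_inj.
Qed.

Lemma plane_free c d : d != 0 -> free [:: plane_vec 1 0; plane_vec c d].
Proof.
move=> d0; rewrite free_cons seq1_free span_seq1; apply/andP; split.
  apply/negP => /vlineP[k] /rowP H; have := H 0; have := H 1.
  rewrite !mxE /= => /esym/eqP; rewrite mulf_eq0 (negPf d0) orbF => /eqP ->.
  by rewrite mul0r => /eqP; rewrite oner_eq0.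
apply: contraNneq d0 => /rowP/(_ 1); by rewrite !mxE /= => ->.
Qed.

Variables c p : nat -> C.
Hypothesis c_real : forall t, (0 < t)%N -> c t \is Num.real.
Hypothesis cp : forall t, (0 < t)%N -> c t ^+ 2 < p t.

Definition model_x (t : nat) : plane := plane_vec 1 0.
Definition model_y (t : nat) : plane :=
  plane_vec (c t) (sqrtC (p t - c t ^+ 2)).
Local Notation x := model_x.
Local Notation y := model_y.

Lemma model_xx s t : '[x s, x t] = 1.
Proof. by rewrite plane_dot conjC1 conjC0 mul1r mul0r addr0. Qed.

Lemma model_xy s t : (0 < t)%N -> '[x s, y t] = c t.
Proof. by move=> t0; rewrite plane_dot mul0r addr0 mul1r (CrealP _) ?c_real. Qed.

Lemma model_yx s t : '[y t, x s] = c t.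
Proof. by rewrite plane_dot conjC1 conjC0 mulr0 addr0 mulr1. Qed.

Lemma model_yy t : (0 < t)%N -> '[y t, y t] = p t.
Proof.
move=> t0; rewrite plane_dot (CrealP _) ?c_real // [X in _ + _ * X](CrealP _).
  by rewrite -!expr2 sqrtCK subrKC.
by rewrite realE sqrtC_ge0 subr_ge0 ltW // cp.
Qed.

Let d0 t : (0 < t)%N -> sqrtC (p t - c t ^+ 2) != 0.
Proof. by move=> t0; rewrite sqrtC_eq0 subr_eq0 gt_eqF // cp. Qed.

Variables X Y : nat -> nat -> tens plane plane.

Definition model_beta s t : 'Hom(plane, tens plane plane) :=
  linfun (sval (linear_of_free [:: x (s + t)%N; y (s + t)%N]
                 [:: X s t; Y s t])).

Lemma model_betaE s t : (0 < t)%N ->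
  model_beta s t (x (s + t)%N) = X s t /\ model_beta s t (y (s + t)%N) = Y s t.
Proof.
move=> t0; rewrite !lfunE /=; case: linear_of_free => f /= Hf.
have := Hf (plane_free _ (d0 (ltn_addl s t0))) erefl.
by case.
Qed.

Hypothesis XX : forall s t, (0 < s)%N -> (0 < t)%N -> '[X s t, X s t] = 1.
Hypothesis XY : forall s t, (0 < s)%N -> (0 < t)%N ->
  '[X s t, Y s t] = c (s + t).
Hypothesis YY : forall s t, (0 < s)%N -> (0 < t)%N ->
  '[Y s t, Y s t] = p (s + t).

Lemma plane_dim t : (0 < t)%N -> \dim {: plane} = 2%N.
Proof. by rewrite dimvf dim_matrix. Qed.

Lemma model_isometry s t : (0 < s)%N -> (0 < t)%N ->
  forall u v, '[model_beta s t u, model_beta s t v] = '[u, v].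
Proof.
move=> s0 t0 u v; have st0 := ltn_addl s t0.
have YX : '[Y s t, X s t] = c (s + t).
  by rewrite hermC /= XY // mul1r (CrealP _) ?c_real.
have [Bx By] := model_betaE s t0.
have [a [b ->]] := plane_decomp (c (s + t)) u (d0 st0).
have [a' [b' ->]] := plane_decomp (c (s + t)) v (d0 st0).
have BE a1 b1 : model_beta s t (a1 *: x (s + t)%N + b1 *: y (s + t)%N) =
    a1 *: X s t + b1 *: Y s t by rewrite linearP linearZ /= Bx By.
rewrite -/(x (s + t)%N) -/(y (s + t)%N) !BE.
rewrite (hdot_comb (V := tens plane plane)) (hdot_comb (V := plane)).
by rewrite XX ?XY ?YY ?YX ?model_xx ?model_xy ?model_yx ?model_yy.
Qed.

Hypothesis coX : forall r s t, (0 < r)%N -> (0 < s)%N -> (0 < t)%N ->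
  tens_assoc _ _ _ (tens_map (model_beta r s) \1%VF (X (r + s) t)) =
  tens_map \1%VF (model_beta s t) (X r (s + t)).
Hypothesis coY : forall r s t, (0 < r)%N -> (0 < s)%N -> (0 < t)%N ->
  tens_assoc _ _ _ (tens_map (model_beta r s) \1%VF (Y (r + s) t)) =
  tens_map \1%VF (model_beta s t) (Y r (s + t)).

Lemma model_coassoc r s t : (0 < r)%N -> (0 < s)%N -> (0 < t)%N ->
  forall u : plane,
  tens_assoc _ _ _ (tens_map (model_beta r s) \1%VF
    (model_beta (r + s) t (ecast n plane (addnA r s t) u))) =
  tens_map \1%VF (model_beta s t) (model_beta r (s + t) u).
Proof.
move=> r0 s0 t0 u.
have -> : ecast n plane (addnA r s t) u = u by case: _ / (addnA r s t).
have st0 := ltn_addl s t0; have rst0 := ltn_addl r st0.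
have [Bx By] := model_betaE (r + s) t0.
have [Bx' By'] := model_betaE r st0.
have [a [b ->]] := plane_decomp (c (r + (s + t))) u (d0 rst0).
rewrite -/(x (r + (s + t))%N) -/(y (r + (s + t))%N).
rewrite (hom_comb (model_beta r (s + t))) Bx' By'.
rewrite addnA (hom_comb (model_beta (r + s) t)) Bx By.
rewrite (hom_comb (tens_map (model_beta r s) \1%VF)).
rewrite (hom_comb (tens_map (V := plane) \1%VF (model_beta s t))).
by rewrite (hom_comb (tens_assoc plane plane plane)) coX ?coY.
Qed.

Definition model : subproduct_system C :=
  @SubproductSystem C (fun _ => plane) model_beta plane_dim model_isometry
    model_coassoc.

End Model.

Section Classification.
Variable C : numClosedFieldType.

(* In the partial order of C, 0 <= a < 1 forces a to be real, so that it      *)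
(* describes the real interval [0, 1).                                        *)
Inductive sps_type : Type :=
| Type1 (a : C) of 0 <= a < 1
| Type2 (a : C) of 0 <= a < 1
| Type3 (lambda : C) of lambda != 0
| Type4
| Type5.

Definition is_basis (T : sps_type) (E : subproduct_system C)
    (x y : forall t, E t) : Prop :=
  match T with
  | Type1 a _ => forall s t, (0 < s)%N -> (0 < t)%N ->
      [/\ hnorm (x t) = 1, hnorm (y t) = 1, '[x t, y t] = a ^+ t,
          beta E s t (x (s + t)%N) = x s \ox x t
        & beta E s t (y (s + t)%N) = y s \ox y t]
  | Type2 a _ => forall s t, (0 < s)%N -> (0 < t)%N ->
      [/\ hnorm (x t) = 1, hnorm (y t) = 1, '[x t, y t] = a ^+ t,
          ~~ odd s -> beta E s t (x (s + t)%N) = x s \ox x t /\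
                      beta E s t (y (s + t)%N) = y s \ox y t
        & odd s -> beta E s t (x (s + t)%N) = x s \ox y t /\
                   beta E s t (y (s + t)%N) = y s \ox x t]
  | Type3 lambda _ => forall s t, (0 < s)%N -> (0 < t)%N ->
      [/\ hnorm (x t) = 1,
          hnorm (y t) ^+ 2 = \sum_(i < t) `|lambda| ^+ (2 * i),
          '[x t, y t] = 0,
          beta E s t (x (s + t)%N) = x s \ox x t
        & beta E s t (y (s + t)%N) =
            y s \ox x t + lambda ^+ s *: (x s \ox y t)]
  | Type4 => forall s t, (0 < s)%N -> (0 < t)%N ->
      [/\ hnorm (x t) = 1, hnorm (y t) = 1, '[x t, y t] = 0,
          beta E s t (x (s + t)%N) = x s \ox x t
        & beta E s t (y (s + t)%N) = y s \ox x t]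
  | Type5 => forall s t, (0 < s)%N -> (0 < t)%N ->
      [/\ hnorm (x t) = 1, hnorm (y t) = 1, '[x t, y t] = 0,
          beta E s t (x (s + t)%N) = x s \ox x t
        & beta E s t (y (s + t)%N) = x s \ox y t]
  end.

Lemma homD (V W : hilbert C) (f : 'Hom(V, W)) (u v : V) :
  f (u + v) = f u + f v.
Proof. exact: linearD. Qed.
Lemma homZ (V W : hilbert C) (f : 'Hom(V, W)) a (u : V) :
  f (a *: u) = a *: f u.
Proof. exact: linearZ. Qed.

Lemma hnorm1 (V : hilbert C) (v : V) : '[v, v] = 1 -> hnorm v = 1.
Proof. by rewrite /hnorm => ->; rewrite sqrtC1. Qed.

Lemma a_lt1 (a : C) t : 0 <= a < 1 -> (0 < t)%N -> (a ^+ t) ^+ 2 < 1.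
Proof.
move=> /andP[a0 a1] t0; rewrite -exprM.
by rewrite exprn_ilt1 // muln_eq0 negb_or -lt0n t0.
Qed.

Lemma normX_sum (lambda : C) s t :
  \sum_(i < s) `|lambda| ^+ (2 * i) +
    `|lambda| ^+ (2 * s) * \sum_(i < t) `|lambda| ^+ (2 * i) =
  \sum_(i < s + t) `|lambda| ^+ (2 * i).
Proof.
rewrite big_split_ord /=; congr (_ + _); rewrite mulr_sumr.
by apply: eq_bigr => i _; rewrite mulnDr exprD.
Qed.

Lemma normX_sum_gt0 (lambda : C) t : (0 < t)%N ->
  0 < \sum_(i < t) `|lambda| ^+ (2 * i).
Proof.
case: t => // t _; rewrite big_ord_recl muln0 expr0 ltr_pwDl //.
by apply: sumr_ge0 => i _; rewrite exprn_ge0.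
Qed.

Lemma calE_exists (T : sps_type) : exists E : subproduct_system C,
  exists x y : forall t, E t, is_basis T x y.
Proof.
case: T => [a a01|a a01|lambda l0||].
- pose c t : C := a ^+ t; pose p (t : nat) : C := 1.
  have cr t : (0 < t)%N -> c t \is Num.real 
    by move=> _; case/andP: a01 => a0 _; rewrite realE exprn_ge0.
  have cp t : (0 < t)%N -> c t ^+ 2 < p t by exact: a_lt1.
  pose x := @model_x C; pose y := @model_y C c p.
  pose X s t := x s \ox x t; pose Y s t := y s \ox y t.
  have B s t (t0 : (0 < t)%N) := model_betaE cp X Y s t0.
  unshelve eexists.
    apply: (@model C c p cr cp X Y) => [s t s0 t0|s t s0 t0|s t s0 t0|r s t r0 s0 t0|r s t r0 s0 t0].
    + by rewrite tens_dot !model_xx mul1r.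
    + by rewrite tens_dot !model_xy // /c exprD.
    + by rewrite tens_dot !model_yy // mul1r.
    + rewrite !tens_map_pure !id_lfunE (B _ _ s0).1 ?(B _ _ t0).1.
      by rewrite tens_assoc_pure.
    + rewrite !tens_map_pure !id_lfunE (B _ _ s0).2 ?(B _ _ t0).2.
      by rewrite tens_assoc_pure.
  exists x, y => s t s0 t0 /=; split; rewrite ?(B _ _ t0).1 ?(B _ _ t0).2 //.
  + by rewrite hnorm1 ?model_xx.
  + by rewrite hnorm1 ?model_yy.
  + exact: model_xy.
- pose c t : C := a ^+ t; pose p (t : nat) : C := 1.
  have cr t : (0 < t)%N -> c t \is Num.real 
    by move=> _; case/andP: a01 => a0 _; rewrite realE exprn_ge0.
  have cp t : (0 < t)%N -> c t ^+ 2 < p t by exact: a_lt1.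
  pose x := @model_x C; pose y := @model_y C c p.
  pose X s t := if odd s then x s \ox y t else x s \ox x t.
  pose Y s t := if odd s then y s \ox x t else y s \ox y t.
  have Xt s t : odd s = true -> X s t = x s \ox y t by rewrite /X => ->.
  have Xf s t : odd s = false -> X s t = x s \ox x t by rewrite /X => ->.
  have Yt s t : odd s = true -> Y s t = y s \ox x t by rewrite /Y => ->.
  have Yf s t : odd s = false -> Y s t = y s \ox y t by rewrite /Y => ->.
  have B s t (t0 : (0 < t)%N) := model_betaE cp X Y s t0.
  unshelve eexists.
    apply: (@model C c p cr cp X Y) => [s t s0 t0|s t s0 t0|s t s0 t0|r s t r0 s0 t0|r s t r0 s0 t0].
    + by rewrite /X; case: odd; rewrite tens_dot ?model_xx ?model_yy // mul1r.
    + rewrite /X /Y; case: odd; rewrite tens_dot ?model_xy // ?model_yx //;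
      by rewrite /c exprD.
    + by rewrite /Y; case: odd; rewrite tens_dot ?model_xx ?model_yy // mul1r.
    + have ors := oddD r s; case or : (odd r) ors; case os : (odd s) => ors;
      rewrite ?(Xt _ _ ors) ?(Xf _ _ ors) ?(Xt _ _ or) ?(Xf _ _ or);
      rewrite !tens_map_pure !id_lfunE ?(B _ _ s0).1 ?(B _ _ t0).1
        ?(B _ _ s0).2 ?(B _ _ t0).2;
      rewrite ?(Xt _ _ or) ?(Xf _ _ or) ?(Yt _ _ or) ?(Yf _ _ or);
      rewrite ?(Xt _ _ os) ?(Xf _ _ os) ?(Yt _ _ os) ?(Yf _ _ os);
      by rewrite tens_assoc_pure.
    + have ors := oddD r s; case or : (odd r) ors; case os : (odd s) => ors;
      rewrite ?(Yt _ _ ors) ?(Yf _ _ ors) ?(Yt _ _ or) ?(Yf _ _ or);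
      rewrite !tens_map_pure !id_lfunE ?(B _ _ s0).1 ?(B _ _ t0).1
        ?(B _ _ s0).2 ?(B _ _ t0).2;
      rewrite ?(Xt _ _ or) ?(Xf _ _ or) ?(Yt _ _ or) ?(Yf _ _ or);
      rewrite ?(Xt _ _ os) ?(Xf _ _ os) ?(Yt _ _ os) ?(Yf _ _ os);
      by rewrite tens_assoc_pure.
  exists x, y => s t s0 t0 /=.
  rewrite (B _ _ t0).1 (B _ _ t0).2 /X /Y; split.
  + by rewrite hnorm1 ?model_xx.
  + by rewrite hnorm1 ?model_yy.
  + exact: model_xy.
  + by move/negbTE->.
  + by move->.
- pose c (t : nat) : C := 0; pose p t : C := \sum_(i < t) `|lambda| ^+ (2 * i).
  have cr t : (0 < t)%N -> c t \is Num.real by rewrite real0.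
  have cp t : (0 < t)%N -> c t ^+ 2 < p t.
    by move=> t0; rewrite expr0n normX_sum_gt0.
  pose x := @model_x C; pose y := @model_y C c p.
  pose X s t := x s \ox x t.
  pose Y s t := y s \ox x t + lambda ^+ s *: (x s \ox y t).
  have B s t (t0 : (0 < t)%N) := model_betaE cp X Y s t0.
  have Y1 s t : Y s t = 1 *: (y s \ox x t) + lambda ^+ s *: (x s \ox y t).
    by rewrite scale1r.
  have X1 s t : X s t = 1 *: (x s \ox x t) + 0 *: (x s \ox x t).
    by rewrite scale1r scale0r addr0.
  unshelve eexists.
    apply: (@model C c p cr cp X Y) => [s t s0 t0|s t s0 t0|s t s0 t0|r s t r0 s0 t0|r s t r0 s0 t0].
    + by rewrite tens_dot !model_xx mul1r.
    + rewrite X1 Y1 (hdot_comb (V := tens (plane C) (plane C))) !tens_dot.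
      by rewrite !model_xx !model_xy // !mul0r !mulr0 !addr0.
    + rewrite Y1 (hdot_comb (V := tens (plane C) (plane C))) !tens_dot.
      rewrite !model_xx !model_xy // !model_yx // !model_yy //.
      rewrite !mul0r !mulr0 !mulr1 !mul1r add0r addr0 conjC1 mul1r mulrA.
      by rewrite -normCK normrX -exprM [(s * 2)%N]mulnC normX_sum.
    + rewrite !tens_map_pure !id_lfunE (B _ _ s0).1 ?(B _ _ t0).1.
      by rewrite tens_assoc_pure.
    + rewrite !homD !homZ !tens_map_pure !id_lfunE.
      rewrite (B _ _ s0).1 (B _ _ s0).2 (B _ _ t0).1 (B _ _ t0).2.
      rewrite /X /Y pureDl pureZl pureDr pureZr !homD !homZ !tens_assoc_pure.
      by rewrite scalerDr scalerA exprD addrA.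
  exists x, y => s t s0 t0 /=; split; rewrite ?(B _ _ t0).1 ?(B _ _ t0).2 //.
  + by rewrite hnorm1 ?model_xx.
  + by rewrite /hnorm sqrtCK model_yy.
  + exact: model_xy.
- pose c (t : nat) : C := 0; pose p (t : nat) : C := 1.
  have cr t : (0 < t)%N -> c t \is Num.real by rewrite real0.
  have cp t : (0 < t)%N -> c t ^+ 2 < p t by rewrite expr0n ltr01.
  pose x := @model_x C; pose y := @model_y C c p.
  pose X s t := x s \ox x t; pose Y s t := y s \ox x t.
  have B s t (t0 : (0 < t)%N) := model_betaE cp X Y s t0.
  unshelve eexists.
    apply: (@model C c p cr cp X Y) => [s t s0 t0|s t s0 t0|s t s0 t0|r s t r0 s0 t0|r s t r0 s0 t0].
    + by rewrite tens_dot !model_xx mul1r.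
    + by rewrite tens_dot !model_xy // mul0r.
    + by rewrite tens_dot model_xx model_yy // mul1r.
    + rewrite !tens_map_pure !id_lfunE (B _ _ s0).1 ?(B _ _ t0).1.
      by rewrite tens_assoc_pure.
    + rewrite !tens_map_pure !id_lfunE (B _ _ s0).2 ?(B _ _ t0).1.
      by rewrite tens_assoc_pure.
  exists x, y => s t s0 t0 /=; split; rewrite ?(B _ _ t0).1 ?(B _ _ t0).2 //.
  + by rewrite hnorm1 ?model_xx.
  + by rewrite hnorm1 ?model_yy.
  + exact: model_xy.
- pose c (t : nat) : C := 0; pose p (t : nat) : C := 1.
  have cr t : (0 < t)%N -> c t \is Num.real by rewrite real0.
  have cp t : (0 < t)%N -> c t ^+ 2 < p t by rewrite expr0n ltr01.
  pose x := @model_x C; pose y := @model_y C c p.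
  pose X s t := x s \ox x t; pose Y s t := x s \ox y t.
  have B s t (t0 : (0 < t)%N) := model_betaE cp X Y s t0.
  unshelve eexists.
    apply: (@model C c p cr cp X Y) => [s t s0 t0|s t s0 t0|s t s0 t0|r s t r0 s0 t0|r s t r0 s0 t0].
    + by rewrite tens_dot !model_xx mul1r.
    + by rewrite tens_dot !model_xy // mulr0.
    + by rewrite tens_dot model_xx model_yy // mul1r.
    + rewrite !tens_map_pure !id_lfunE (B _ _ s0).1 ?(B _ _ t0).1.
      by rewrite tens_assoc_pure.
    + rewrite !tens_map_pure !id_lfunE (B _ _ s0).1 ?(B _ _ t0).2.
      by rewrite tens_assoc_pure.
  exists x, y => s t s0 t0 /=; split; rewrite ?(B _ _ t0).1 ?(B _ _ t0).2 //.
  + by rewrite hnorm1 ?model_xx.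
  + by rewrite hnorm1 ?model_yy.
  + exact: model_xy.
Qed.

Definition calE (T : sps_type) : subproduct_system C :=
  projT1 (cid (calE_exists T)).

Lemma calE_basis (T : sps_type) : exists x y : forall t, calE T t,
  is_basis T x y.
Proof. exact: (projT2 (cid (calE_exists T))). Qed.

End Classification.

(* Main.v *)
Require Import Defs.
From mathcomp Require Import all_boot all_order all_algebra.
From mathcomp Require Import sesquilinear boolp.
From mathcomp Require Import complex reals ring.

(** The classification takes place in degrees 1 and 2, over any numerically closed
    field. Let [V = E_1], and let [L] be the range of [beta 1 1], a plane (a pencil
    of tensors) in [V (x) V].

    The pair of [V] and [L] determines the system. The fiber of degree [n + 2] is
    embedded into the intersection of [E_1 (x) E_(n+1)] and [E_2 (x) E_n], and in
    the model systems this intersection is itself two-dimensional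
    ([basis_quadratic]). Therefore a unitary map of the fibers of degree 1 which
    matches the pencils extends, one degree at a time, to an isomorphism
    ([isomorphic_of_quadratic]). Conversely an isomorphism matches the pencils.
    Hence [E] is isomorphic to the system of type [T] if and only if its pencil is
    the one of type [T] ([pencil_isomorphic], [isomorphic_pencil]), and it remains
    to classify pencils up to unitary maps of [V].

    Existence ([has_pencil_ex]). The fiber of degree 3 embeds into the
    intersection of [V (x) L] and [L (x) V], which must thus have dimension at
    least 2. The determinant has a zero on [L], so [L] contains some nonzero
    [u (x) v]. If [L] contains a square [x (x) x], take [y] orthogonal to [x]:
    the dimension condition says that the second generator
    [al x (x) y + be y (x) x + ga y (x) y] satisfies [ga = 0], which gives the
    types 3, 4 and 5, or [al = be], in which case [L] contains a second square and
    has type 1. If [L] contains no square, the dimension condition forces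
    [L] to be spanned by [u (x) v] and [v (x) u], which is type 2.

    Uniqueness ([has_pencil_uniq]). The number of lines of vectors with square in
    [L] is 2 for type 1, 0 for type 2 and 1 for the others. For the types 1 and 2
    the lines of [x] and [y] can be recovered from [L] and their angle gives the
    parameter [a]; for the types 3 to 5 the ratio of the coefficients of
    [y (x) x] and [x (x) y] is an invariant. *)

Set Implicit Arguments.
Unset Strict Implicit.
Unset Printing Implicit Defensive.

Import Order.TTheory GRing.Theory Num.Theory Num.Def.
Local Open Scope ring_scope.

(** * Tensor products *)

Section Tensors.
Variable C : numClosedFieldType.
Implicit Types V W X U : hilbert C.

Lemma dotDl V (u v w : V) : '[u + v, w] = '[u, w] + '[v, w].
Proof. by rewrite linearDl. Qed.
Lemma dotDr V (u v w : V) : '[w, u + v] = '[w, u] + '[w, v].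
Proof. by rewrite linearDr. Qed.
Lemma dotZl V a (u w : V) : '[a *: u, w] = a * '[u, w].
Proof. by rewrite linearZl_LR. Qed.
Lemma dotZr V a (u w : V) : '[w, a *: u] = a^* * '[w, u].
Proof. by rewrite linearZr_LR. Qed.
Lemma dot0l V (w : V) : '[0, w] = 0.
Proof. by rewrite linear0l. Qed.
Lemma dotC V (u v : V) : '[u, v] = '[v, u]^*.
Proof. by rewrite hermC /= mul1r. Qed.

Definition dotE := (dotDl, dotDr, dotZl, dotZr).
Definition homE := (homD, homZ).
Definition pureE := (pureDl, pureDr, pureZl, pureZr).

Lemma pure0r V W (v : V) : v \ox (0 : W) = 0.
Proof. by rewrite -(scale0r (0 : W)) pureZr !scale0r. Qed.

Lemma tens_sum V W (A : tens V W) :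
  A = \sum_i \sum_j (A : 'M_(_, _)) i j *: (tnth (onb V) i \ox tnth (onb W) j).
Proof.
apply/matrixP => k l; rewrite summxE (bigD1 k) //= summxE (bigD1 l) //= !mxE.
rewrite !onb_dot !eqxx !mulr1 !big1 ?addr0 //.
  move=> i ik; rewrite summxE big1 // => j _.
  by rewrite !mxE !onb_dot (negPf ik) mul0r mulr0.
by move=> j jl; rewrite !mxE !onb_dot (negPf jl) !mulr0.
Qed.

(** Pure tensors span. Closure under [a *: A + B] is all that an identity of
    linear or sesquilinear expressions has to satisfy to be reduced to them. *)
Lemma tens_ind V W (P : tens V W -> Prop) :
  (forall v w, P (v \ox w)) -> (forall a A B, P A -> P B -> P (a *: A + B)) ->
  forall A, P A.
Proof.
move=> Ppure Plin A.
have P0 : P 0 by rewrite -(pure0r W (0 : V)); exact: Ppure.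
have PD A' B : P A' -> P B -> P (A' + B).
  by move=> PA PB; rewrite -[A']scale1r; apply: Plin.
rewrite (tens_sum A); apply: big_ind => // i _; apply: big_ind => // j _.
by rewrite -[X in P X]addr0; apply: Plin.
Qed.

Lemma tens_map_comp V V' V'' W W' W'' (f : 'Hom(V, V')) (f' : 'Hom(V', V''))
    (g : 'Hom(W, W')) (g' : 'Hom(W', W'')) A :
  tens_map f' g' (tens_map f g A) = tens_map (f' \o f)%VF (g' \o g)%VF A.
Proof.
elim/tens_ind: A => [v w|a A B IA IB]; last by rewrite !homE IA IB.
by rewrite !tens_map_pure !comp_lfunE.
Qed.

Lemma tens_map_eq V V' W W' (f f' : 'Hom(V, V')) (g g' : 'Hom(W, W')) A :
  f =1 f' -> g =1 g' -> tens_map f g A = tens_map f' g' A.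
Proof. by move=> /lfunP-> /lfunP->. Qed.

Lemma tens_assoc_nat V V' W W' X X' (f : 'Hom(V, V')) (g : 'Hom(W, W'))
    (h : 'Hom(X, X')) A :
  tens_map f (tens_map g h) (tens_assoc V W X A) =
  tens_assoc V' W' X' (tens_map (tens_map f g) h A).
Proof.
elim/tens_ind: A => [A x|a A B IA IB]; last by rewrite !homE IA IB.
elim/tens_ind: A => [v w|a A B IA IB]; last by rewrite !(pureE, homE) IA IB.
by rewrite !(tens_map_pure, tens_assoc_pure).
Qed.

(** The half of [unitary] that can be checked on pure tensors. *)
Definition isometric V W (f : V -> W) := forall u v, '[f u, f v] = '[u, v].

Lemma isometric_inj V W (f : 'Hom(V, W)) : isometric f -> injective f.
Proof.
move=> fi u v fuv; apply/eqP; rewrite -subr_eq0 -(dnorm_eq0 (hdot V)) -fi.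
by rewrite linearB /= fuv subrr dot0l.
Qed.

Lemma tens_isometric V W X (f : 'Hom(tens V W, X)) :
  (forall v w v' w',
     '[f (v \ox w), f (v' \ox w')] = '[v \ox w, v' \ox w']) -> isometric f.
Proof.
move=> fi A B; elim/tens_ind: A => [v w|a A A' IA IA']; last first.
  by rewrite homE homZ !dotE IA IA'.
by elim/tens_ind: B => [v' w'|a B B' IB IB'] //; rewrite homE homZ !dotE IB IB'.
Qed.

Lemma tens_map_isometric V V' W W' (f : 'Hom(V, V')) (g : 'Hom(W, W')) :
  isometric f -> isometric g -> isometric (tens_map f g).
Proof.
by move=> fi gi; apply: tens_isometric => *; rewrite !tens_map_pure !tens_dot fi gi.
Qed.

Lemma tens_assoc_isometric V W X : isometric (tens_assoc V W X).
Proof.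
apply: tens_isometric => A x B y; rewrite tens_dot.
elim/tens_ind: A => [v w|a A A' IA IA']; last first.
  by rewrite pureE pureZl homE homZ !dotE IA IA' mulrDl mulrA.
elim/tens_ind: B => [v' w'|a B B' IB IB']; last first.
  by rewrite pureE pureZl homE homZ !dotE IB IB' mulrDl mulrA.
by rewrite !tens_assoc_pure !tens_dot mulrA.
Qed.

Lemma id_isometric V : isometric (\1%VF : 'Hom(V, V)).
Proof. by move=> u v; rewrite !id_lfunE. Qed.

Definition slice V W (d : V) : 'Hom(tens V W, W) :=
  tens_lift (fun v w => '[v, d] *: w).

Lemma slice_pure V W (d v : V) (w : W) : slice W d (v \ox w) = '[v, d] *: w.
Proof.
rewrite /slice tens_lift_pure // => [w'|v'] a u u'.
  by rewrite !dotE scalerDl scalerA.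
by rewrite scalerDr !scalerA mulrC.
Qed.

(** The contractions of tensors are offered through their defining properties
    only: a failing match against a transparent definition would unfold tensors
    into matrices. This one contracts the first two factors of a triple tensor. *)
Lemma coef_ex V W : exists coef : V -> V -> 'Hom(tens V (tens V W), W),
  forall d d' v v' w,
    coef d d' (v \ox (v' \ox w)) = ('[v, d] * '[v', d']) *: w.
Proof.
exists (fun d d' => (slice W d' \o slice (tens V W) d)%VF) => d d' v v' w.
by rewrite comp_lfunE slice_pure homZ slice_pure scalerA.
Qed.

Lemma coef2_ex V : exists coef : V -> V -> tens V V -> C,
  [/\ forall d d' A B, coef d d' (A + B) = coef d d' A + coef d d' B,
      forall d d' a A, coef d d' (a *: A) = a * coef d d' A
    & forall d d' v v', coef d d' (v \ox v') = '[v, d] * '[v', d']].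
Proof.
exists (fun d d' A => '[slice V d A, d']).
split=> [d d' A B|d d' a A|d d' v v'].
- by rewrite homD dotDl.
- by rewrite homZ dotZl.
- by rewrite slice_pure dotZl.
Qed.

Lemma coef3_ex V : exists coef : V -> V -> V -> tens V (tens V V) -> C,
  [/\ forall d d' d'', {morph coef d d' d'' : A B / A + B},
      forall d d' d'' a, {morph coef d d' d'' : A / a *: A >-> a * A}
    & forall d d' d'' v v' v'',
      coef d d' d'' (v \ox (v' \ox v'')) = '[v, d] * '[v', d'] * '[v'', d'']].
Proof.
have [co coE] := coef_ex V V.
exists (fun d d' d'' A => '[co d d' A, d'']).
split=> [d d' d'' A B|d d' d'' a A|d d' d'' v v' v''].
- by rewrite homD dotDl.
- by rewrite homZ dotZl.
- by rewrite coE dotZl.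
Qed.

(** A dual basis of [x, y], functionals being represented by vectors. *)
Definition dual V (x y dx dy : V) :=
  [/\ '[x, dx] = 1, '[y, dx] = 0, '[x, dy] = 0 & '[y, dy] = 1].

Lemma free_neq0 V (x y : V) : free [:: x; y] -> y != 0.
Proof. by rewrite free_cons => /andP[_]; rewrite seq1_free. Qed.

Lemma free_sym V (x y : V) : free [:: x; y] = free [:: y; x].
Proof. by apply: perm_free; rewrite -[[:: x; y]]/([:: x] ++ [:: y]) perm_catC. Qed.

Lemma dual_vector_ex V (x y : V) : free [:: x; y] ->
  exists d : V, '[x, d] = 1 /\ '[y, d] = 0.
Proof.
(* The component of [x] orthogonal to [y], scaled to avoid a division. *)
move=> fr; pose z := '[y, y] *: x - '[x, y] *: y.
have y0 : '[y, y] != 0 by rewrite (dnorm_eq0 (hdot V)) (free_neq0 fr).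
have zy : '[z, y] = 0.
  by rewrite /z -scaleNr !dotE mulNr mulrC subrr.
have z0 : z != 0.
  apply/eqP => /eqP; rewrite subr_eq0 => /eqP H; move: fr.
  rewrite free_cons span_seq1 => /andP[/negP[]]; rewrite -[x](scalerK y0) H.
  by rewrite scalerA memvZ // memv_line.
have xz : '[x, z] != 0.
  have : '[z, z] != 0 by rewrite (dnorm_eq0 (hdot V)).
  have -> : '[z, z] = '[y, y] * '[x, z].
    rewrite -[LHS]/('['[y, y] *: x - '[x, y] *: y, z]) -scaleNr !dotDl !dotZl.
    by rewrite (dotC y z) zy conjC0 mulr0 addr0.
  by rewrite mulf_eq0 negb_or => /andP[].
clearbody z; exists (('[x, z]^-1)^* *: z); rewrite !dotE conjCK mulVf //.
by rewrite (dotC y z) zy conjC0 mulr0.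
Qed.

Lemma dual_ex V (x y : V) : free [:: x; y] -> exists dx dy, dual x y dx dy.
Proof.
move=> fr; have [dx [h1 h2]] := dual_vector_ex fr.
rewrite free_sym in fr; have [dy [h3 h4]] := dual_vector_ex fr.
by exists dx, dy.
Qed.

Definition spans V (x y : V) := forall v, exists a b, v = a *: x + b *: y.

Lemma dim2_spans V (x y : V) : \dim {: V} = 2 -> free [:: x; y] -> spans x y.
Proof.
move=> d2 fr v.
have : v \in <<[:: x; y]>>%VS.
  have/andP[/eqP-> _] : basis_of fullv [:: x; y] by rewrite basisEfree fr subvf d2.
  exact: memvf.
rewrite span_cons span_seq1 => /memv_addP[_ /vlineP[a ->] [_ /vlineP[b ->] ->]].
by exists a, b.
Qed.

Lemma tens_decomp V W (x y : V) : spans x y ->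
  forall A : tens V W, exists w1 w2, A = x \ox w1 + y \ox w2.
Proof.
move=> sp; apply: tens_ind => [v w|a A B [w1 [w2 ->]] [w3 [w4 ->]]].
  have [a [b ->]] := sp v; exists (a *: w), (b *: w).
  by rewrite !pureE.
exists (a *: w1 + w3), (a *: w2 + w4).
by rewrite !pureE scalerDr addrACA.
Qed.

Lemma comb_coord V (x y : V) a b a' b' : free [:: x; y] ->
  a *: x + b *: y = a' *: x + b' *: y -> a = a' /\ b = b'.
Proof.
move=> /dual_ex[dx [dy [h1 h2 h3 h4]]] E.
have := congr1 (fun v => '[v, dx]) E; have := congr1 (fun v => '[v, dy]) E.
by rewrite !dotE h1 h2 h3 h4 !mulr1 !mulr0 !add0r !addr0.
Qed.

End Tensors.

(** * Lifting an isomorphism from degree one *)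

Section Lifting.
Variable C : numClosedFieldType.
Implicit Types E F : subproduct_system C.

Lemma beta_isometric E s t : (0 < s)%N -> (0 < t)%N -> isometric (beta E s t).
Proof. by move=> s0 t0 u v; exact: beta_isometry. Qed.

(** With a first factor of degree 1 both sides of coassociativity live in
    convertible fibers, so the transport disappears. *)
Lemma coassoc1 E s t : (0 < s)%N -> (0 < t)%N -> forall u : E (1 + (s + t))%N,
  tens_assoc _ _ _ (tens_map (beta E 1 s) \1%VF (beta E s.+1 t u)) =
  tens_map \1%VF (beta E s t) (beta E 1 (s + t) u).
Proof.
move=> s0 t0 u; rewrite -(@beta_coassoc C E 1 s t isT s0 t0 u).
by rewrite (eq_irrelevance (addnA 1 s t) erefl).
Qed.

(** The fiber of degree [n + 2] is as large as the fiber of degree 2 permits: it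
    is the whole intersection of [F_1 (x) F_(n+1)] with [F_2 (x) F_n]. Such a
    system is determined by its fibers of degrees 1 and 2, like an algebra with
    quadratic relations. *)
Definition quadratic F := forall n, (0 < n)%N ->
  forall (w : tens (F 1%N) (F n.+1)) (z : tens (F 2%N) (F n)),
  tens_map \1%VF (beta F 1 n) w =
    tens_assoc _ _ _ (tens_map (beta F 1 1) \1%VF z) ->
  exists u, w = beta F 1 n.+1 u.

Lemma isometric_unitary (V W : hilbert C) (f : 'Hom(V, W)) :
  \dim {: V} = \dim {: W} -> isometric f -> unitary f.
Proof.
move=> dVW fi; split=> //; have fI := isometric_inj fi.
have f0 : lker f == 0%VS by apply/lker0P.
have fT : limg f = fullv.
  apply/eqP; rewrite eqEdim subvf /= limg_dim_eq ?dVW //.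
  by rewrite (eqP f0) capv0.
exists (f^-1)%VF; first exact: lker0_lfunK.
by move=> w; rewrite limg_lfunVK // fT memvf.
Qed.

Section Lift.
Variables E F : subproduct_system C.
Hypothesis quadF : quadratic F.
Variable theta1 : 'Hom(E 1%N, F 1%N).
Hypothesis theta1_isometric : isometric theta1.
Hypothesis theta1_image : forall u, exists v,
  tens_map theta1 theta1 (beta E 1 1 u) = beta F 1 1 v.

(** Degree by degree, [theta (n + 2)] is the only map through which [beta F] can
    intertwine [theta1] and [theta (n + 1)]; [thetaP] shows that the partial
    inverse is applied inside the range. *)
Fixpoint theta n : 'Hom(E n, F n) :=
  match n with
  | 0 => 0
  | n'.+1 => match n' return 'Hom(E n', F n') -> 'Hom(E n'.+1, F n'.+1) with
     | 0 => fun=> theta1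
     | m.+1 => fun th =>
       ((beta F 1 m.+1)^-1 \o tens_map theta1 th \o beta E 1 m.+1)%VF
     end (theta n')
  end.

(** For the step, [w = (theta1 (x) theta_(n+2)) (beta u)] has to be in the range
    of [beta F]. Applying [beta F] to its second factor and using
    coassociativity in both systems puts [w] into [F_2 (x) F_(n+1)] as well, so
    that [quadratic] applies. *)
Lemma thetaP n : (0 < n)%N -> isometric (theta n) /\
  forall u : E n.+1, beta F 1 n (theta n.+1 u) =
                     tens_map theta1 (theta n) (beta E 1 n u).
Proof.
have imgE k : (0 < k)%N ->
    (forall u, exists v,
      tens_map theta1 (theta k) (beta E 1 k u) = beta F 1 k v) ->
    forall u : E k.+1, beta F 1 k (theta k.+1 u) =
                     tens_map theta1 (theta k) (beta E 1 k u).
  case: k => // k _ im u; rewrite [theta k.+2]/= !comp_lfunE /=.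
  by rewrite limg_lfunVK //; have [v ->] := im u; rewrite memv_img ?memvf.
elim: n => // -[_ _|n IHn _].
  by split=> //; apply: imgE.
have [ison betan] := IHn isT; split.
  move=> u v; rewrite -(@beta_isometric F 1 n.+1 isT isT) !betan.
  by rewrite tens_map_isometric // beta_isometric.
apply: (imgE n.+2) => // u.
have [z] : exists z,
  tens_map \1%VF (beta F 1 n.+1) (tens_map theta1 (theta n.+2) (beta E 1 n.+2 u))
  = tens_assoc _ _ _ (tens_map (beta F 1 1) \1%VF z).
  exists (tens_map (theta 2) (theta n.+1) (beta E 2 n.+1 u)).
  rewrite !tens_map_comp.
  rewrite (tens_map_eq (f' := (theta1 \o \1)%VF)
    (g' := (tens_map theta1 (theta n.+1) \o beta E 1 n.+1)%VF)); last 2 first.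
  - by move=> v; rewrite !comp_lfunE !id_lfunE.
  - by move=> v; rewrite [RHS]comp_lfunE [LHS]comp_lfunE betan.
  rewrite -tens_map_comp -(@coassoc1 E 1 n.+1 isT isT u) tens_assoc_nat.
  rewrite !tens_map_comp; congr (tens_assoc _ _ _ _); apply: tens_map_eq => v.
    by rewrite [LHS]comp_lfunE [RHS]comp_lfunE (imgE 1%N).
  by rewrite !comp_lfunE !id_lfunE.
by move=> H; have [v ->] := @quadF n.+1 isT _ _ H; exists v.
Qed.

(** Compatibility with [beta s t] follows from the case [s = 1] by induction on
    [s], since coassociativity expresses [beta (s + 1) t] through [beta 1 _] and
    [beta s t]. *)
Lemma isomorphic_of_quadratic : isomorphic E F.
Proof.
(* From here on [theta] is used through [thetaP] only, as an abstract family. *)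
have [l l1 lP] : exists2 l : forall n, 'Hom(E n, F n), l 1%N = theta1 &
    forall n, (0 < n)%N -> isometric (l n) /\
      forall u : E n.+1, beta F 1 n (l n.+1 u) =
                         tens_map theta1 (l n) (beta E 1 n u).
  by exists theta => //; exact: thetaP.
exists l; split=> [t t0|s t s0 t0].
  apply: isometric_unitary; first by rewrite !fiber_dim.
  by have [] := lP t t0.
apply/lfunP; elim: s s0 => // -[_ _|s IHs _] u.
  by rewrite !comp_lfunE; have [_ ->] := lP t t0; rewrite l1.
have iso_l : isometric (tens_assoc _ _ _ \o tens_map (beta F 1 s.+1)
    (\1%VF : 'Hom(F t, F t)))%VF.
  move=> A B; rewrite !comp_lfunE tens_assoc_isometric.
  apply: tens_map_isometric; first exact: beta_isometric.
  exact: id_isometric.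
apply: (isometric_inj iso_l); rewrite !comp_lfunE.
rewrite (@coassoc1 F s.+1 t isT t0).
have st0 : (0 < s.+1 + t)%N by [].
have [_ thst] := lP _ st0.
rewrite [X in tens_map _ _ X = _](thst u).
rewrite !tens_map_comp.
rewrite (tens_map_eq (f' := (theta1 \o \1)%VF)
    (g' := (tens_map (l s.+1) (l t) \o beta E s.+1 t)%VF)); last 2 first.
- by move=> v; rewrite !comp_lfunE !id_lfunE.
- by move=> v; rewrite -IHs.
rewrite -tens_map_comp -(@coassoc1 E s.+1 t isT t0) tens_assoc_nat.
rewrite !tens_map_comp; congr (tens_assoc _ _ _ _); apply: tens_map_eq => v.
  by rewrite !comp_lfunE; have [_ ->] := lP s.+1 isT.
by rewrite !comp_lfunE !id_lfunE.
Qed.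

End Lift.
End Lifting.

(** * The systems with a basis are quadratic *)

Section Pencils.
Variable C : numClosedFieldType.
Implicit Types (V W : hilbert C) (T : sps_type C).

(** The patterns common to all types: in a basis of type [T] the vectors
    [beta 1 n (x (n + 1))] and [beta 1 n (y (n + 1))] are [gen1] and [gen2] of the
    basis vectors of degrees 1 and [n]. *)
Definition gen1 T V W (x y : V) (x' y' : W) : tens V W :=
  match T with
  | Type2 _ _ => x \ox y'
  | _ => x \ox x'
  end.

Definition gen2 T V W (x y : V) (x' y' : W) : tens V W :=
  match T with
  | Type1 _ _ => y \ox y'
  | Type2 _ _ => y \ox x'
  | Type3 lambda _ => y \ox x' + lambda *: (x \ox y')
  | Type4 => y \ox x'
  | Type5 => x \ox y'
  end.

(** The inner product of [x 1] and [y 1] in a basis of type [T]. *)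
Definition overlap T : C :=
  match T with Type1 a _ => a | Type2 a _ => a | _ => 0 end.

Lemma overlap_bounds T : 0 <= overlap T < 1.
Proof. by case: T => //=; rewrite lexx ltr01. Qed.

Lemma dot_of_hnorm V (v : V) : '[v, v] = hnorm v ^+ 2.
Proof. by rewrite sqrtCK. Qed.

Lemma gram_free V (x y : V) :
  `|'[x, y]| ^+ 2 != '[x, x] * '[y, y] -> free [:: x; y].
Proof. by have [_ ->] := CauchySchwarz (hdot V) x y; rewrite negbK. Qed.

Section Basis.
Variables (T : sps_type C) (E : subproduct_system C) (x y : forall t, E t).
Hypothesis basisE : is_basis T x y.

Lemma basis_beta n : (0 < n)%N ->
  beta E 1 n (x n.+1) = gen1 T (x 1%N) (y 1%N) (x n) (y n) /\
  beta E 1 n (y n.+1) = gen2 T (x 1%N) (y 1%N) (x n) (y n).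
Proof.
move=> n0; case: T basisE => [a a01|a a01|l l0||] /(_ 1%N n isT n0) [] //=.
by move=> _ _ _ _ [].
Qed.

Lemma basis_gram1 : [/\ '[x 1%N, x 1%N] = 1, '[y 1%N, y 1%N] = 1
                      & '[x 1%N, y 1%N] = overlap T].
Proof.
rewrite !dot_of_hnorm.
case: T basisE => [a a01|a a01|l l0||] /(_ 1%N 1%N isT isT) [-> + -> _ _] /= => ->;
by rewrite ?expr1n ?expr1 // big_ord1 muln0.
Qed.

(** The vectors [x n] and [y n] satisfy the Cauchy-Schwarz inequality strictly. *)
Lemma basis_free n : (0 < n)%N -> free [:: x n; y n].
Proof.
move=> n0; apply: gram_free; rewrite !dot_of_hnorm.
have lt1 (a : C) : 0 <= a < 1 -> `|a ^+ n| ^+ 2 != 1.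
  move=> a01; have /andP[a0 _] := a01; rewrite ger0_norm ?exprn_ge0 //.
  by rewrite lt_eqF // a_lt1.
case: T basisE => [a a01|a a01|l l0||] /(_ 1%N n isT n0) [-> + -> _ _] /= => ->;
  rewrite ?expr1n ?mul1r ?lt1 // normr0 expr0n /= eq_sym ?oner_neq0 //.
by rewrite gt_eqF // normX_sum_gt0.
Qed.

Lemma basis_spans n : (0 < n)%N -> spans (x n) (y n).
Proof. by move=> n0; apply: dim2_spans (basis_free n0); rewrite fiber_dim. Qed.

(** Expand [w] in the four products of basis vectors. Comparing coordinates, the
    hypothesis imposes on the four coefficients two linear conditions, and these
    are the equations of the range of [beta 1 (n + 1)]. *)
Lemma basis_quadratic : quadratic E.
Proof.
move=> n n0 w z.
have [w1 [w2 ->]] := tens_decomp (basis_spans (n := 1) isT) w.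
have [a [b ->]] := basis_spans (n := n.+1) isT w1.
have [c [d ->]] := basis_spans (n := n.+1) isT w2.
have [p [q ->]] := tens_decomp (basis_spans (n := 2) isT) z.
have [b1 b2] := basis_beta (n := 1) isT.
have [bn1 bn2] := basis_beta n0.
have [bs1 bs2] := basis_beta (n := n.+1) isT.
have f1 := basis_free (n := 1) isT; have fn := basis_free n0.
have yn0 := free_neq0 fn.
have xn0 : x n != 0 by move: fn; rewrite free_sym => /free_neq0.
have sc0 k (v : E n) : v != 0 -> k *: v = 0 -> k = 0.
  by move=> v0 /eqP; rewrite scaler_eq0 (negPf v0) orbF => /eqP.
rewrite !homE !tens_map_pure !id_lfunE !homE bn1 bn2 b1 b2.
have [dx [dy [dxx dyx dxy dyy]]] := dual_ex f1.
have dE := (dxx, dyx, dxy, dyy, mulr0, mulr1, scale1r, scale0r, scaler0, add0r,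
  addr0).
have [co coE] := coef_ex (E 1%N) (E n).
move=> H; have := congr1 (co dy dx) H; have := congr1 (co dy dy) H.
have := congr1 (co dx dx) H; have := congr1 (co dx dy) H.
move: bs1 bs2 {H}; set G := ex _.
case: T => [e e01|e e01|l l0||]; rewrite /gen1 /gen2 => bs1 bs2;
  rewrite !pureE !homE !tens_assoc_pure !coE !dE.
- move=> /(sc0 _ _ yn0) b0 _ _ /(sc0 _ _ xn0) c0.
  rewrite /G; exists (a *: x n.+2 + d *: y n.+2).
  by rewrite !homE bs1 bs2 b0 c0 !scale0r addr0 add0r !pureE.
- move=> _ /(sc0 _ _ yn0) a0 /(sc0 _ _ xn0) d0 _.
  rewrite /G; exists (b *: x n.+2 + c *: y n.+2).
  by rewrite !homE bs1 bs2 a0 d0 !scale0r addr0 add0r !pureE.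
- move=> + _ /(sc0 _ _ xn0) d0; rewrite d0 scale0r addr0 => + q_def.
  rewrite -q_def scalerA => /eqP; rewrite -subr_eq0 -scalerBl => /eqP/(sc0 _ _ xn0).
  move=> /eqP; rewrite subr_eq0 => /eqP b_def.
  rewrite /G; exists (a *: x n.+2 + c *: y n.+2).
  rewrite !homE bs1 bs2 b_def d0 scale0r addr0 !pureE scalerDr scalerA mulrC -addrA.
  by congr (_ + _); rewrite addrC.
- move=> /(sc0 _ _ xn0) b0 _ /(sc0 _ _ xn0) d0 _.
  rewrite /G; exists (a *: x n.+2 + c *: y n.+2).
  by rewrite !homE bs1 bs2 b0 d0 !scale0r !addr0 ?add0r !pureE ?pure0r ?addr0.
- move=> _ _ _ cd0; have [c0 d0] : c = 0 /\ d = 0.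
    by apply: (comb_coord fn); rewrite cd0 !scale0r addr0.
  rewrite /G; exists (a *: x n.+2 + b *: y n.+2).
  by rewrite !homE bs1 bs2 c0 d0 !scale0r !addr0 ?add0r !pureE ?pure0r ?addr0.
Qed.
End Basis.
End Pencils.

(** * A system is determined by its pencil *)

Section Criterion.
Variable C : numClosedFieldType.
Implicit Types (V W : hilbert C) (T : sps_type C) (E F : subproduct_system C).

Definition gram T V (u v : V) :=
  [/\ '[u, u] = 1, '[v, v] = 1 & '[u, v] = overlap T].

(** The range of [beta 1 1] is, up to a unitary map of the fiber of degree 1, the
    one found in the systems of type [T]. This characterizes the systems of type
    [T]: see [pencil_isomorphic] and [isomorphic_pencil]. *)
Definition has_pencil T E := exists (u v : E 1%N) (e f : E 2%N),
  [/\ gram T u v, spans e f, beta E 1 1 e = gen1 T u v u v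
    & beta E 1 1 f = gen2 T u v u v].

Lemma gram_free_overlap T V (u v : V) : gram T u v -> free [:: u; v].
Proof.
move=> [uu vv uv]; apply: gram_free; rewrite uu vv uv mulr1.
have /andP[a0 a1] := overlap_bounds T.
by rewrite ger0_norm // lt_eqF // exprn_ilt1.
Qed.

Lemma tens_map_gen T V W (f : 'Hom(V, W)) (u v : V) :
  tens_map f f (gen1 T u v u v) = gen1 T (f u) (f v) (f u) (f v) /\
  tens_map f f (gen2 T u v u v) = gen2 T (f u) (f v) (f u) (f v).
Proof.
by rewrite /gen1 /gen2; case: T => *; rewrite ?(homE, tens_map_pure).
Qed.

Lemma pencil_isomorphic T E F (x y : forall t, F t) :
  is_basis T x y -> has_pencil T E -> isomorphic E F.
Proof.
move=> bF [u [v [e [f [guv ef be bf]]]]].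
have [xx yy xy] := basis_gram1 bF; have [uu vv uv] := guv.
have fr := gram_free_overlap guv.
have [g /(_ fr erefl)[gu gv]] := linear_of_free [:: u; v] [:: x 1%N; y 1%N].
pose th : 'Hom(E 1%N, F 1%N) := linfun g.
have thu : th u = x 1%N by rewrite lfunE.
have thv : th v = y 1%N by rewrite lfunE.
have [bx by_] := basis_beta bF (n := 1) isT.
apply: (isomorphic_of_quadratic (basis_quadratic bF) (theta1 := th)) => [w w'|w].
  have sp := dim2_spans (@fiber_dim C E 1%N isT) fr.
  have [a [b ->]] := sp w; have [a' [b' ->]] := sp w'.
  rewrite !hom_comb !hdot_comb thu thv xx yy uu vv uv (dotC (y 1%N)) xy.
  by rewrite (dotC v) uv.
have [a [b ->]] := ef w; exists (a *: x 2%N + b *: y 2%N).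
rewrite !hom_comb be bf bx by_.
by have [-> ->] := tens_map_gen T th u v; rewrite thu thv.
Qed.

Lemma isomorphic_pencil T E F (x y : forall t, F t) :
  is_basis T x y -> isomorphic E F -> has_pencil T E.
Proof.
move=> bF [th [thU thb]].
have th0 t : (0 < t)%N -> isometric (th t) by move=> t0; have [] := thU t t0.
have [_ [g1 _ g1K]] := thU 1%N isT; have [_ [g2 g2V g2K]] := thU 2%N isT.
have [xx yy xy] := basis_gram1 bF.
have [bx by_] := basis_beta bF (n := 1) isT.
have [G1 G2] := tens_map_gen T (th 1%N) (g1 (x 1%N)) (g1 (y 1%N)).
have thb1 w : beta F 1 1 (th 2%N w) = tens_map (th 1%N) (th 1%N) (beta E 1 1 w).
  by have := thb 1%N 1%N isT isT => /lfunP/(_ w); rewrite !comp_lfunE.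
have inj := isometric_inj (tens_map_isometric (th0 1%N isT) (th0 1%N isT)).
exists (g1 (x 1%N)), (g1 (y 1%N)), (g2 (x 2%N)), (g2 (y 2%N)); split.
- by split; rewrite -(th0 1%N isT) !g1K.
- move=> w; have [a [b E2]] := basis_spans bF (n := 2) isT (th 2%N w).
  exists a, b; apply: (can_inj g2V).
  by rewrite hom_comb !g2K.
- by apply: inj; rewrite -thb1 g2K bx G1 !g1K.
- by apply: inj; rewrite -thb1 g2K by_ G2 !g1K.
Qed.

End Criterion.

(** * Distinct types have inequivalent pencils *)

Section Uniqueness.
Variable C : numClosedFieldType.
Implicit Types (V : hilbert C) (T : sps_type C) (E : subproduct_system C).

Definition in_pencil T V (u v : V) (A : tens V V) :=
  exists a b, A = a *: gen1 T u v u v + b *: gen2 T u v u v.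

Lemma pencil_meet T T' E : has_pencil T E -> has_pencil T' E ->
  exists u v u' v' : E 1%N, [/\ gram T u v, gram T' u' v',
    in_pencil T u v (gen1 T' u' v' u' v') & in_pencil T u v (gen2 T' u' v' u' v')].
Proof.
move=> [u [v [e [f [g ef be bf]]]]] [u' [v' [e' [f' [g' ef' be' bf']]]]].
exists u, v, u', v'; split=> //; rewrite -?be' -?bf' /in_pencil -be -bf.
  by have [a [b ->]] := ef e'; exists a, b; rewrite hom_comb.
by have [a [b ->]] := ef f'; exists a, b; rewrite hom_comb.
Qed.

(** For the types 3 to 5 the coefficients of [y (x) x] and [x (x) y] in [gen2];
    they form the invariant that separates these types. *)
Definition mixing T : C * C :=
  match T with Type3 l _ => (1, l) | Type5 => (0, 1) | _ => (1, 0) end.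

(** The number of lines spanned by vectors [p] with [p (x) p] in the pencil. *)
Definition square_lines T : nat :=
  match T with Type1 _ _ => 2 | Type2 _ _ => 0 | _ => 1 end.

Lemma pure_comb V (u v : V) p q r s : (p *: u + q *: v) \ox (r *: u + s *: v) =
  (p * r) *: (u \ox u) + (p * s) *: (u \ox v) + (q * r) *: (v \ox u)
    + (q * s) *: (v \ox v).
Proof. by rewrite !pureE !scalerDr !scalerA addrA. Qed.

(** The two linear equations of the pencil, read off from its generators. *)
Lemma in_pencilP T V (u v : V) a11 a12 a21 a22 : gram T u v ->
  in_pencil T u v (a11 *: (u \ox u) + a12 *: (u \ox v) + a21 *: (v \ox u)
                    + a22 *: (v \ox v)) ->
  match square_lines T with
  | 2 => a12 = 0 /\ a21 = 0
  | 0 => a11 = 0 /\ a22 = 0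
  | _ => a22 = 0 /\ a12 * (mixing T).1 = a21 * (mixing T).2
  end.
Proof.
move=> /gram_free_overlap /dual_ex[du [dv [uu vu uv vv]]] [a [b H]].
have [co [coD coZ coP]] := coef2_ex V.
move: (congr1 (co du du) H) (congr1 (co du dv) H).
move: (congr1 (co dv du) H) (congr1 (co dv dv) H).
clear H; case: T => [e e01|e e01|l l0||]; rewrite /gen1 /gen2 /=;
  rewrite !(coD, coZ) !coP !(uu, vu, uv, vv).
all: rewrite !(mulr0, mulr1, addr0, add0r).
- by move=> -> _ _ ->.
- by move=> _ -> -> _.
- by move=> -> -> _ ->.
- by move=> _ -> _ ->.
- by move=> -> -> _ _.
Qed.

(** If the determinant of the coordinates vanished, the rows of the adjugate
    matrix would be relations between [u'] and [v']. *)
Lemma gram_coords T V (u v u' v' : V) : spans u v -> gram T u' v' ->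
  exists p q r s, [/\ u' = p *: u + q *: v, v' = r *: u + s *: v
                   & p * s != q * r].
Proof.
move=> sp g; have fr := gram_free_overlap g.
have [p [q u'E]] := sp u'; have [r [s v'E]] := sp v'.
exists p, q, r, s; split=> //; apply/eqP => psqr.
have H : s *: u' + (- q) *: v' = 0.
  rewrite u'E v'E !scalerDr !scalerA addrACA -!scalerDl.
  have -> : s * p + - q * r = 0 by rewrite mulrC psqr; ring.
  have -> : s * q + - q * s = 0 by ring.
  by rewrite !scale0r addr0.
have H' : (- r) *: u' + p *: v' = 0.
  rewrite u'E v'E !scalerDr !scalerA addrACA -!scalerDl.
  have -> : - r * p + p * r = 0 by ring.
  have -> : - r * q + p * s = 0 by rewrite psqr; ring.
  by rewrite !scale0r addr0.
have [s0 q0] : s = 0 /\ - q = 0.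
  by apply: (comb_coord fr); rewrite H !scale0r addr0.
have [r0 p0] : - r = 0 /\ p = 0.
  by apply: (comb_coord fr); rewrite H' !scale0r addr0.
move/eqP: q0; rewrite oppr_eq0 => /eqP q0.
by have := free_neq0 fr; rewrite free_sym in fr; have := free_neq0 fr;
  rewrite u'E p0 q0 !scale0r addr0 eqxx.
Qed.

Lemma overlap_norm (c a b : C) :
  0 <= a < 1 -> 0 <= b < 1 -> `|c| = 1 -> a = c * b -> a = b.
Proof.
move=> /andP[a0 _] /andP[b0 _] c1 ab.
by rewrite -(ger0_norm a0) ab normrM c1 mul1r ger0_norm.
Qed.

Lemma gram_diag T T' V (u v u' v' : V) p s : gram T u v -> gram T' u' v' ->
  u' = p *: u -> v' = s *: v -> overlap T' = overlap T.
Proof.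
move=> [uu vv uv] [u'u' v'v' u'v'] u'E v'E.
have np : `|p| ^+ 2 = 1 by rewrite -u'u' u'E dotZl dotZr uu mulr1 normCK.
have ns : `|s| ^+ 2 = 1 by rewrite -v'v' v'E dotZl dotZr vv mulr1 normCK.
apply: (overlap_norm (c := p * s^*)) (overlap_bounds _) (overlap_bounds _) _ _.
  apply: (pexpIrn (n := 2)) => //; rewrite ?nnegrE // normrM norm_conjC exprMn.
  by rewrite np ns mulr1 expr1n.
by rewrite -u'v' -uv u'E v'E dotZl dotZr mulrA.
Qed.

Lemma gram_sym T V (u v : V) : gram T u v -> gram T v u.
Proof.
move=> [uu vv uv]; split=> //; rewrite dotC uv.
by have /andP[a0 _] := overlap_bounds T; rewrite (CrealP _) // ger0_real.
Qed.

(** Write a second basis [u', v'] in terms of the first, [u, v]. The squares in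
    the pencil (for type 2, which has none, the product [u' (x) v']) force the
    lines of [u'] and [v'] to be those of [u] and [v], up to order, so that the
    overlaps agree. For the types 3 to 5 only the line of [u] is forced, but [v]
    is orthogonal to it, and [in_pencilP] compares the mixing coefficients. *)
Lemma has_pencil_uniq T T' E : has_pencil T E -> has_pencil T' E -> T = T'.
Proof.
(* By symmetry [T] may be assumed to have the smaller number of square lines. *)
suff H : forall T T', has_pencil T E -> has_pencil T' E ->
    (square_lines T <= square_lines T')%N ->
    square_lines T = square_lines T' /\ overlap T = overlap T' /\
    (square_lines T = 1 ->
       (mixing T).1 * (mixing T').2 = (mixing T).2 * (mixing T').1).
  move=> h h'; have [e1 [e2 e3]] : square_lines T = square_lines T' /\
      overlap T = overlap T' /\ (square_lines T = 1 ->
       (mixing T).1 * (mixing T').2 = (mixing T).2 * (mixing T').1).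
    have [le|/ltnW le] := leqP (square_lines T) (square_lines T').
      exact: H.
    have [-> [-> e3]] := H _ _ h' h le; split=> //; split=> // /e3 e.
    by rewrite mulrC -e mulrC.
  move: e1 e2 e3; clear; case: T => [a a01|a a01|l l0||];
    case: T' => [b b01|b b01|m m0||] //= _.
  - move=> ab _; move: a01; rewrite ab => a01.
    by rewrite (bool_irrelevance a01 b01).
  - move=> ab _; move: a01; rewrite ab => a01.
    by rewrite (bool_irrelevance a01 b01).
  - move=> _ /(_ erefl); rewrite mulr1 mul1r => ml; move: m0; rewrite ml => m0.
    by rewrite (bool_irrelevance m0 l0).
  - move=> _ /(_ erefl); rewrite mulr1 mulr0 => e; exfalso.
    by move: l0; rewrite -e eqxx.
  - by move=> _ /(_ erefl)/eqP; rewrite mulr1 mulr0 oner_eq0.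
  - move=> _ /(_ erefl); rewrite mul1r mul0r => e; exfalso.
    by move: m0; rewrite e eqxx.
  - by move=> _ /(_ erefl)/eqP; rewrite mulr1 mulr0 oner_eq0.
  - by move=> _ /(_ erefl)/eqP; rewrite mul0r mulr1 eq_sym oner_eq0.
  - by move=> _ /(_ erefl)/eqP; rewrite mul0r mulr1 eq_sym oner_eq0.
move=> {}T {}T' h h' le.
have [u [v [u' [v' [g g' i1 i2]]]]] := pencil_meet h h'.
have sp := dim2_spans (@fiber_dim C E 1%N isT) (gram_free_overlap g).
have [p [q [r [s [u'E v'E ne]]]]] := gram_coords sp g'.
have diag (p' q' r' s' : C) : p' * s' != q' * r' -> p' * q' = 0 -> r' * s' = 0 ->
    (q' = 0 /\ r' = 0) \/ (p' = 0 /\ s' = 0).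
  move=> ne' /eqP; rewrite mulf_eq0 => /orP[]/eqP z1 /eqP;
  rewrite mulf_eq0 => /orP[]/eqP z2; move: ne';
  by rewrite ?z1 ?z2 ?(mulr0, mul0r) ?eqxx; auto.
have ovl : (q = 0 /\ r = 0) \/ (p = 0 /\ s = 0) -> overlap T = overlap T'.
  case=> -[z1 z2]; symmetry.
    apply: (gram_diag g g'); first by rewrite u'E z1 scale0r addr0.
    by rewrite v'E z2 scale0r add0r.
  apply: (gram_diag (gram_sym g) g'); first by rewrite u'E z1 scale0r add0r.
  by rewrite v'E z2 scale0r addr0.
have psq (a : C) : a * a = 0 -> a = 0 by move/eqP; rewrite mulf_eq0 orbb => /eqP.
have I1 : square_lines T' != 0%N -> in_pencil T u v (u' \ox u').
  by move: i1; rewrite /gen1; case: (T').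
case Tk: (square_lines T) => [|[|k]].
- have nosq : square_lines T' = 0%N.
    apply/eqP/negPn/negP => /I1; rewrite {1}u'E {1}u'E pure_comb.
    move=> /(in_pencilP g); rewrite Tk => -[/psq p0 /psq q0].
    by move: ne; rewrite p0 q0 !mul0r eqxx.
  split=> //; split=> //; apply: ovl.
  have : in_pencil T u v (u' \ox v') by move: i1 nosq; rewrite /gen1; case: (T').
  rewrite u'E v'E pure_comb => /(in_pencilP g); rewrite Tk => -[pr qs].
  have ne' : p * s != r * q by rewrite (mulrC r).
  by case: (diag p r q s ne' pr qs) => -[z1 z2]; auto.
- have : in_pencil T u v (u' \ox u').
    by apply: I1; case: (square_lines T') le; rewrite Tk.
  rewrite u'E pure_comb => /(in_pencilP g); rewrite Tk => -[/psq q0 _].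
  have ps : p * s != 0 by move: ne; rewrite q0 mul0r.
  have two : square_lines T' != 2%N.
    apply/eqP => T'2.
    have : in_pencil T u v (v' \ox v') by move: i2 T'2; rewrite /gen2; case: (T').
    rewrite v'E pure_comb => /(in_pencilP g); rewrite Tk => -[/psq s0 _].
    by move: ps; rewrite s0 mulr0 eqxx.
  have T'k : square_lines T' = 1%N by move: le two; rewrite Tk; case: (T').
  have ov T0 : square_lines T0 = 1%N -> overlap T0 = 0 by case: T0.
  have mix T0 (a b : E 1%N) : square_lines T0 = 1%N -> gen2 T0 a b a b =
      (mixing T0).1 *: (b \ox a) + (mixing T0).2 *: (a \ox b).
    by rewrite /gen2 /mixing; case: T0 => // *;
      rewrite ?scale1r ?scale0r ?add0r ?addr0.
  split=> //; split=> [|_]; first by rewrite !ov.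
  have [uu _ uv] := g; have [_ _ u'v'] := g'.
  have r0 : r = 0.
    move: u'v'; rewrite u'E v'E q0 scale0r addr0 dotZl dotDr !dotZr uv uu !ov //.
    rewrite mulr0 addr0 mulr1 => /eqP; rewrite mulf_eq0 conjC_eq0.
    by case/orP=> /eqP // p0; move: ps; rewrite p0 mul0r eqxx.
  move: i2; rewrite mix // u'E v'E q0 r0 !scale0r addr0 add0r.
  rewrite !pureZl !pureZr !scalerA.
  set a21 := _ * _; set a12 := _ * _.
  have -> : a21 *: (v \ox u) + a12 *: (u \ox v) =
      0 *: (u \ox u) + a12 *: (u \ox v) + a21 *: (v \ox u) + 0 *: (v \ox v).
    by rewrite !scale0r add0r addr0 addrC.
  move=> /(in_pencilP g); rewrite Tk => -[_ e].
  apply: (mulfI ps); transitivity (a12 * (mixing T).1); first by rewrite /a12; ring.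
  by rewrite e /a21; ring.
- have Tk' : square_lines T = 2%N by move: Tk; case: (T).
  have T'k : square_lines T' = 2%N by move: le; rewrite Tk'; case: (T').
  rewrite -Tk Tk' T'k; split=> //; split=> //; apply: ovl.
  have : in_pencil T u v (u' \ox u') by apply: I1; rewrite T'k.
  rewrite u'E pure_comb => /(in_pencilP g); rewrite Tk' => -[pq _].
  have : in_pencil T u v (v' \ox v') by move: i2 T'k; rewrite /gen2; case: (T').
  rewrite v'E pure_comb => /(in_pencilP g); rewrite Tk' => -[rs _].
  exact: diag.
Qed.
End Uniqueness.

(** * Every pencil has one of the types *)

Section Existence.
Variable C : numClosedFieldType.
Implicit Types (V W : hilbert C) (T : sps_type C) (E : subproduct_system C).

Lemma free_complete V (x : V) : \dim {: V} = 2%N -> x != 0 ->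
  exists y, free [:: x; y].
Proof.
move=> d2 x0; have [y yx] : exists y, y \notin <[x]>%VS.
  apply: contrapT => H; have /dimvS : (fullv <= <[x]>)%VS.
    apply/subvP => y _; apply: contrapT => yx; apply: H; exists y; exact/negP.
  by rewrite d2 dim_vline x0.
by exists y; rewrite free_sym free_cons seq1_free x0 span_seq1 yx.
Qed.

Lemma free2_ex V : \dim {: V} = 2%N -> exists x y : V, free [:: x; y].
Proof.
move=> d2; have x0 : vpick (fullv : {vspace V}) != 0 by rewrite vpick0 -dimv_eq0 d2.
by have [y] := free_complete d2 x0; exists (vpick (fullv : {vspace V})), y.
Qed.

Lemma ker_ex V (phi : V -> C) : \dim {: V} = 2%N ->
  {morph phi : u v / u + v} -> (forall a, {morph phi : u / a *: u >-> a * u}) ->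
  exists2 v, v != 0 & phi v = 0.
Proof.
move=> d2 phiD phiZ.
have [x [y fr]] := free2_ex d2.
have [px0|px0] := eqVneq (phi x) 0.
  by exists x => //; move: fr; rewrite free_sym => /free_neq0.
exists (phi y *: x + (- phi x) *: y); last by rewrite phiD !phiZ mulNr mulrC subrr.
apply/eqP => H; have [_ /eqP] : phi y = 0 /\ - phi x = 0.
  by apply: (comb_coord fr); rewrite H !scale0r addr0.
by rewrite oppr_eq0 (negPf px0).
Qed.

Lemma unit_scale V (v : V) : v != 0 ->
  exists2 c, c != 0 & '[c *: v, c *: v] = 1.
Proof.
move=> v0; have n0 : 0 < '[v, v] by rewrite dnorm_gt0.
have s0 : 0 < sqrtC '[v, v] by rewrite sqrtC_gt0.
exists (sqrtC '[v, v])^-1; first by rewrite invr_eq0 gt_eqF.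
rewrite dotZl dotZr mulrA (CrealP _) ?rpredV ?gtr0_real // -invfM -expr2 sqrtCK.
by rewrite mulVf // gt_eqF.
Qed.

Lemma orthonormal_complete V (x : V) : \dim {: V} = 2%N -> '[x, x] = 1 ->
  exists y, '[y, y] = 1 /\ '[x, y] = 0.
Proof.
move=> d2 xx; have x0 : x != 0 by rewrite -(dnorm_eq0 (hdot V)) xx oner_eq0.
have [w fr] := free_complete d2 x0.
pose y := w + (- '[w, x]) *: x.
have yx : '[y, x] = 0 by rewrite /y dotDl dotZl xx mulr1 subrr.
have y0 : y != 0.
  apply/eqP => H; have [_ /eqP] : - '[w, x] = 0 /\ 1 = 0 :> C.
    by apply: (comb_coord fr); rewrite scale1r !scale0r addr0 addrC -H.
  by rewrite oner_eq0.
have [c c0 cc] := unit_scale y0; exists (c *: y); split=> //.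
by rewrite dotZr dotC yx conjC0 mulr0.
Qed.

(** The phase of [d] makes the inner product nonnegative, and Cauchy-Schwarz
    makes it less than 1. *)
Lemma gram_scale V (x y : V) : free [:: x; y] -> exists c d,
  [/\ c != 0, d != 0, '[c *: x, c *: x] = 1, '[d *: y, d *: y] = 1
    & 0 <= '[c *: x, d *: y] < 1].
Proof.
move=> fr; have y0 := free_neq0 fr.
have x0 : x != 0 by move: fr; rewrite free_sym => /free_neq0.
have [c c0 cc] := unit_scale x0; have [d d0 dd] := unit_scale y0.
pose z := '[c *: x, d *: y].
have fr' : free [:: c *: x; d *: y].
  move: fr; rewrite (free_cons x) (free_cons (c *: x)) !span_seq1 !seq1_free.
  rewrite scaler_eq0 (negPf d0) /=.
  move=> /andP[xy ->]; rewrite andbT; apply: contra xy => /vlineP[k e].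
  by rewrite -[x](scalerK c0) e !scalerA memvZ // memv_line.
have z1 : `|z| < 1.
  have [le eq] := CauchySchwarz (hdot V) (c *: x) (d *: y).
  move: le eq; rewrite cc dd mulr1 fr' /= => le eq.
  by rewrite -(@expr_lt1 _ 2) // lt_neqAle eq.
have [z0|z0] := eqVneq z 0.
  by exists c, d; split=> //; rewrite -/z z0 lexx ltr01.
have nz0 : `|z| != 0 by rewrite normr_eq0.
exists c, (z / `|z| * d); split=> //.
- by rewrite mulf_neq0 // mulf_neq0 // invr_eq0.
- rewrite -scalerA dotZl dotZr dd mulr1 -normCK normrM normfV normr_id.
  by rewrite divff // expr1n.
- rewrite -scalerA dotZr -/z rmorphM /= fmorphV /= (CrealP (normr_real z)).
  rewrite mulrAC mulrC -normCKC expr2 mulrA mulVf // mul1r z1 andbT.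
  exact: normr_ge0.
Qed.

Lemma rank_one V (x y : V) a b c d : a * d = b * c ->
  exists u v, a *: (x \ox x) + b *: (x \ox y) + c *: (y \ox x) + d *: (y \ox y)
    = u \ox v.
Proof.
move=> adbc.
have [a0|a0] := eqVneq a 0; last first.
  exists (1 *: x + (c / a) *: y), (a *: x + b *: y).
  rewrite pure_comb !mul1r divfK //; congr (_ + _ *: _).
  by apply: (mulfI a0); rewrite adbc mulrCA mulrA divfK // mulrC.
have /eqP : b * c = 0 by rewrite -adbc a0 mul0r.
rewrite mulf_eq0 => /orP[]/eqP z0.
  by exists y, (c *: x + d *: y); rewrite a0 z0 !scale0r !add0r !pureE.
by exists (b *: x + d *: y), y; rewrite a0 z0 !scale0r add0r addr0 !pureE.
Qed.

(** The determinant is a quadratic form on the pencil, so it has a nontrivial zero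
    over an algebraically closed field. *)
Lemma pencil_rank_one V W (f : 'Hom(W, tens V V)) (x y : V) (e e' : W) :
  spans x y -> exists s t u v, (s != 0) || (t != 0) /\
    f (s *: e + t *: e') = u \ox v.
Proof.
move=> sp.
have co (A : tens V V) : exists a b c d, A = a *: (x \ox x) + b *: (x \ox y) +
   c *: (y \ox x) + d *: (y \ox y).
  have [w1 [w2 ->]] := tens_decomp sp A.
  have [a [b ->]] := sp w1; have [c [d ->]] := sp w2.
  by exists a, b, c, d; rewrite !pureE addrA.
have [a [b [c [d fe]]]] := co (f e); have [a' [b' [c' [d' fe']]]] := co (f e').
have [D0|D0] := eqVneq (a * d - b * c) 0.
  have [u [v uv]] := rank_one x y (subr0_eq D0).
  by exists 1, 0, u, v; rewrite oner_neq0 scale1r scale0r addr0 fe.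
(* [s] is a root of the determinant of [s f(e) + f(e')], divided by [D]. *)
pose D := a * d - b * c.
pose P (i : nat) := if i == 0%N then - (a' * d' - b' * c') / D
  else - (a * d' + a' * d - b * c' - b' * c) / D.
have [s sE] := @solve_monicpoly C 2 P isT.
have [u [v uv]] : exists u v, (s * a + a') *: (x \ox x) + (s * b + b') *: (x \ox y)
   + (s * c + c') *: (y \ox x) + (s * d + d') *: (y \ox y) = u \ox v.
  apply: rank_one; apply: subr0_eq.
  move: sE; rewrite !big_ord_recl big_ord0 addr0 /P /= expr0 expr1 mulr1 => sE.
  transitivity (D * s ^+ 2 + (a * d' + a' * d - b * c' - b' * c) * s
    + (a' * d' - b' * c')); first by rewrite /D; ring.
  by rewrite sE; field; exact: D0.
exists s, 1, u, v; rewrite oner_neq0 orbT; split=> //.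
rewrite hom_comb fe fe' -uv scale1r !scalerDr !scalerA !scalerDl.
by rewrite addrACA; congr (_ + _); rewrite addrACA; congr (_ + _); rewrite addrACA.
Qed.

(** With [L] the span of [A1] and [A2], and [x, y] a basis of [V]: the
    intersection of [V (x) L] and [L (x) V] has dimension at least 2, put in the
    form in which it is used, that every functional vanishes at one of its
    nonzero elements. *)
Definition extendable V (x y : V) (A1 A2 : tens V V) :=
  forall phi : tens V (tens V V) -> C,
  {morph phi : A B / A + B} -> (forall a, {morph phi : A / a *: A >-> a * A}) ->
  exists t, [/\ t != 0, phi t = 0,
    exists a1 a2 a3 a4,
      t = x \ox (a1 *: A1 + a2 *: A2) + y \ox (a3 *: A1 + a4 *: A2)
  & exists b1 b2 b3 b4, t = tens_assoc V V V
      (A1 \ox (b1 *: x + b2 *: y) + A2 \ox (b3 *: x + b4 *: y))].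

(** The fiber of degree 3 embeds into this intersection by coassociativity, and
    it has dimension 2. *)
Lemma beta_extendable E (x y : E 1%N) (e f : E 2%N) : spans x y -> spans e f ->
  extendable x y (beta E 1 1 e) (beta E 1 1 f).
Proof.
move=> xy ef phi phiD phiZ.
pose t (u : E 3%N) := tens_map \1%VF (beta E 1 1) (beta E 1 2 u).
have [u u0 pu] : exists2 u, u != 0 & phi (t u) = 0.
  apply: ker_ex; first exact: fiber_dim.
    by move=> u v; rewrite /t !homD phiD.
  by move=> a u; rewrite /t !homZ phiZ.
exists (t u); split=> //.
- apply: contra u0 => /eqP tu; have ti : isometric t.
    move=> v w; rewrite /t tens_map_isometric; first exact: beta_isometry.
      exact: id_isometric.
    exact: beta_isometric.
  by rewrite -(dnorm_eq0 (hdot (E 3%N))) -ti tu dot0l.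
- have [w1 [w2 bu]] := tens_decomp xy (beta E 1 2 u).
  have [a1 [a2 w1E]] := ef w1; have [a3 [a4 w2E]] := ef w2.
  exists a1, a2, a3, a4.
  by rewrite /t bu w1E w2E homD !tens_map_pure !id_lfunE !hom_comb.
- have [w1 [w2 bu]] := tens_decomp ef (beta E 2 1 u).
  have [b1 [b2 w1E]] := xy w1; have [b3 [b4 w2E]] := xy w2.
  exists b1, b2, b3, b4.
  rewrite /t -(@coassoc1 C E 1 1 isT isT u) bu !homD !tens_map_pure !id_lfunE.
  by rewrite w1E w2E.
Qed.

(** The two expressions of a common element of [V (x) L] and [L (x) V], compared
    coordinate by coordinate. The coordinate along [e, e', e''] can be made to
    vanish without making the element zero. *)
Lemma extendable_coef V (x y : V) (A1 A2 : tens V V) co2 e e' e'' :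
  (forall d d' A B, co2 d d' (A + B) = co2 d d' A + co2 d d' B) ->
  (forall d d' a A, co2 d d' (a *: A) = a * co2 d d' A) ->
  (forall d d' v v', co2 d d' (v \ox v') = '[v, d] * '[v', d']) ->
  extendable x y A1 A2 -> exists a1 a2 a3 a4 b1 b2 b3 b4 : C,
  [/\ ~ [/\ a1 = 0, a2 = 0, a3 = 0 & a4 = 0],
      '[x, e] * (a1 * co2 e' e'' A1 + a2 * co2 e' e'' A2) +
      '[y, e] * (a3 * co2 e' e'' A1 + a4 * co2 e' e'' A2) = 0
    & forall d d' d'',
      '[x, d] * (a1 * co2 d' d'' A1 + a2 * co2 d' d'' A2) +
      '[y, d] * (a3 * co2 d' d'' A1 + a4 * co2 d' d'' A2) =
      co2 d d' A1 * (b1 * '[x, d''] + b2 * '[y, d'']) +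
      co2 d d' A2 * (b3 * '[x, d''] + b4 * '[y, d''])].
Proof.
move=> co2D co2Z co2P; have [co [coD coZ coP]] := coef3_ex V.
have col d d' d'' v A : co d d' d'' (v \ox A) = '[v, d] * co2 d' d'' A.
  elim/tens_ind: A => [w w'|a A B IA IB]; first by rewrite coP co2P mulrA.
  by rewrite pureDr pureZr coD coZ co2D co2Z IA IB; ring.
have cor d d' d'' A v :
    co d d' d'' (tens_assoc V V V (A \ox v)) = co2 d d' A * '[v, d''].
  elim/tens_ind: A => [w w'|a A B IA IB].
    by rewrite tens_assoc_pure coP co2P.
  by rewrite pureDl pureZl homD homZ coD coZ co2D co2Z IA IB; ring.
move=> /(_ _ (coD e e' e'') (coZ e e' e'')).
move=> [t [t0 pt [a1 [a2 [a3 [a4 tE]]]] [b1 [b2 [b3 [b4 tE']]]]]].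
exists a1, a2, a3, a4, b1, b2, b3, b4; split.
- move=> [z1 z2 z3 z4]; move: t0; rewrite tE z1 z2 z3 z4.
  by rewrite !scale0r addr0 !pure0r addr0 eqxx.
- by rewrite -pt tE coD !col !co2D !co2Z.
- move=> d d' d''; rewrite -!co2Z -!co2D -!col -coD -tE tE' homD coD !cor.
  by rewrite !dotDl !dotZl.
Qed.

(** The tensor [x (x) x (x) x] is common to [V (x) L] and [L (x) V] for every
    pencil [L] that contains [x (x) x]. Making its coordinate vanish leaves an
    element which is zero unless the conclusion holds. *)
Lemma extendable_square V (x y : V) al be ga : free [:: x; y] ->
  extendable x y (x \ox x) (al *: (x \ox y) + be *: (y \ox x) + ga *: (y \ox y)) ->
  ga = 0 \/ al = be.
Proof.
move=> /dual_ex[dx [dy [xx yx xy yy]]] R.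
have [co [coD coZ coP]] := coef2_ex V.
have [a1 [a2 [a3 [a4 [b1 [b2 [b3 [b4 [ne pt E]]]]]]]]] :=
  extendable_coef dx dx dx coD coZ coP R.
move: pt (E dx dx dx) (E dx dx dy) (E dx dy dx) (E dx dy dy).
move: (E dy dx dx) (E dy dx dy) (E dy dy dx) (E dy dy dy); clear E R.
rewrite !(coD, coZ) !coP !(xx, yx, xy, yy).
rewrite !(mulr0, mul0r, mulr1, mul1r, addr0, add0r).
move=> a3E a4al a4be a4ga a10 _ _ _ a2ga.
have [|ga0] := eqVneq ga 0; [by left|right; apply/eqP].
apply: contrapT => /negP albe; apply: ne.
have b4E : b4 = a4 by apply: (mulfI ga0); rewrite -a4ga mulrC.
have a40 : a4 = 0.
  apply/eqP; have /eqP : a4 * (al - be) = 0 by rewrite mulrBr a4al b4E; ring.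
  by rewrite mulf_eq0 subr_eq0 (negPf albe) orbF.
have a20 : a2 = 0 by apply: (mulIf ga0); rewrite a2ga b4E a40 mulr0 mul0r.
have b30 : b3 = 0 by apply: (mulfI ga0); rewrite -a4be a40 mul0r mulr0.
by split=> //; rewrite a3E b30 mulr0.
Qed.

(** In each excluded case the solutions of the coordinate equations form a space
    of dimension at most 1, and a coordinate that determines them is made to
    vanish. The second and third cases of the conclusion add a square [x (x) x] or
    [y (x) y] to the pencil. *)
Lemma extendable_swap V (x y : V) al be ga : free [:: x; y] ->
  extendable x y (x \ox y) (al *: (x \ox x) + be *: (y \ox x) + ga *: (y \ox y)) ->
  [\/ al = 0 /\ ga = 0, be = 0 /\ ga = 0 | be = 0 /\ al = 0].
Proof.
move=> /dual_ex[dx [dy [xx yx xy yy]]] R.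
have [co [coD coZ coP]] := coef2_ex V.
have H e e' e'' : exists a1 a2 a3 a4 b1 b2 b3 b4 : C,
  [/\ ~ [/\ a1 = 0, a2 = 0, a3 = 0 & a4 = 0],
    '[x, e] * (a1 * ('[x, e'] * '[y, e'']) + a2 * (al * ('[x, e'] * '[x, e''])
       + be * ('[y, e'] * '[x, e'']) + ga * ('[y, e'] * '[y, e'']))) +
    '[y, e] * (a3 * ('[x, e'] * '[y, e'']) + a4 * (al * ('[x, e'] * '[x, e''])
       + be * ('[y, e'] * '[x, e'']) + ga * ('[y, e'] * '[y, e'']))) = 0
  & [/\ a2 * al = al * b3, a1 = al * b4, a4 * al = be * b3 & a3 = be * b4] /\
    [/\ a4 * be = ga * b3 & a4 * ga = ga * b4]].
  have [a1 [a2 [a3 [a4 [b1 [b2 [b3 [b4 [ne pt E]]]]]]]]] :=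
    extendable_coef e e' e'' coD coZ coP R.
  exists a1, a2, a3, a4, b1, b2, b3, b4; split=> //.
    by rewrite -pt !(coD, coZ) !coP.
  move: (E dx dx dx) (E dx dx dy) (E dy dx dx) (E dy dx dy).
  move: (E dy dy dx) (E dy dy dy).
  clear E R; rewrite !(coD, coZ) !coP !(xx, yx, xy, yy).
  by rewrite !(mulr0, mul0r, mulr1, mul1r, addr0, add0r).
have simp := (xx, yx, xy, yy, mulr0, mul0r, mulr1, mul1r, addr0, add0r).
have nz (k a : C) : k != 0 -> k * a = 0 -> a = 0.
  by move=> k0 /eqP; rewrite mulf_eq0 (negPf k0) => /eqP.
have [al0|al0] := eqVneq al 0.
  have [|ga0] := eqVneq ga 0; first by constructor 1.
  have [|be0] := eqVneq be 0; first by constructor 3.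
  have [a1 [a2 [a3 [a4 [b1 [b2 [b3 [b4 [ne pt]]]]]]]]] := H dx dy dy.
  move=> [[_ a1E beb3 a3E] [a4be a4ga]]; case: ne.
  move: pt; rewrite !simp [a2 * _]mulrC => /(nz _ _ ga0) a20.
  move: beb3; rewrite al0 mulr0 => /esym/(nz _ _ be0) b30.
  move: a4be; rewrite b30 mulr0 mulrC => /(nz _ _ be0) a40.
  move: a4ga; rewrite a40 mul0r => /esym/(nz _ _ ga0) b40.
  by split=> //; rewrite ?a1E ?a3E b40 mulr0.
have [ga0|ga0] := eqVneq ga 0; last first.
  have [a1 [a2 [a3 [a4 [b1 [b2 [b3 [b4 [ne pt]]]]]]]]] := H dx dx dx.
  move=> [[a2al a1E a4al a3E] [a4be a4ga]]; case: ne.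
  move: pt; rewrite !simp [a2 * _]mulrC => /(nz _ _ al0) a20.
  move: a2al; rewrite a20 mul0r => /esym/(nz _ _ al0) b30.
  move: a4al; rewrite b30 mulr0 mulrC => /(nz _ _ al0) a40.
  move: a4ga; rewrite a40 mul0r => /esym/(nz _ _ ga0) b40.
  by split=> //; rewrite ?a1E ?a3E b40 mulr0.
have [|be0] := eqVneq be 0; first by constructor 2.
have [a1 [a2 [a3 [a4 [b1 [b2 [b3 [b4 [ne pt]]]]]]]]] := H dx dx dy.
move=> [[a2al a1E a4al a3E] [a4be a4ga]]; case: ne.
move: pt; rewrite !simp => a10.
move: a1E; rewrite a10 => /esym/(nz _ _ al0) b40.
move: a4be; rewrite ga0 mul0r mulrC => /(nz _ _ be0) a40.
move: a4al; rewrite a40 mul0r => /esym/(nz _ _ be0) b30.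
move: a2al; rewrite b30 mulr0 mulrC => /(nz _ _ al0) a20.
by split=> //; rewrite a3E b40 mulr0.
Qed.

Lemma free_of_indep V (x y : V) :
  (forall a b, a *: x + b *: y = 0 -> a = 0 /\ b = 0) -> free [:: x; y].
Proof.
move=> ind; rewrite free_cons span_seq1 seq1_free; apply/andP; split.
  apply/negP => /vlineP[k xE]; have [/eqP] : 1 = 0 :> C /\ - k = 0.
    by apply: ind; rewrite xE scale1r scaleNr subrr.
  by rewrite oner_eq0.
apply/eqP => y0; have [_ /eqP] : 0 = 0 :> C /\ 1 = 0 :> C.
  by apply: ind; rewrite y0 scale0r scaler0 addr0.
by rewrite oner_eq0.
Qed.

Lemma gen_indep T V (u v : V) a b : gram T u v ->
  a *: gen1 T u v u v + b *: gen2 T u v u v = 0 -> a = 0 /\ b = 0.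
Proof.
move=> g ab0.
have /dual_ex[du [dv [uu vu uv vv]]] := gram_free_overlap g.
have [co [coD coZ coP]] := coef2_ex V.
have co0 d d' : co d d' 0 = 0 by rewrite -(scale0r 0) coZ mul0r.
move: (congr1 (co du du) ab0) (congr1 (co du dv) ab0).
move: (congr1 (co dv du) ab0) (congr1 (co dv dv) ab0).
clear ab0 g; rewrite !co0; case: T => [c c01|c c01|l l0||]; rewrite /gen1 /gen2;
  rewrite !(coD, coZ) !coP !(uu, vu, uv, vv);
  by rewrite !(mulr0, mulr1, addr0, add0r).
Qed.

Lemma has_pencil_intro T E (u v : E 1%N) (e f : E 2%N) : gram T u v ->
  beta E 1 1 e = gen1 T u v u v -> beta E 1 1 f = gen2 T u v u v ->
  has_pencil T E.
Proof.
move=> g be bf; exists u, v, e, f; split=> //.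
apply: dim2_spans; first exact: fiber_dim.
apply: free_of_indep => a b ab0; apply: (gen_indep g).
by rewrite -be -bf -hom_comb ab0 linear0.
Qed.

Lemma spans_shift V (e f : V) a : spans e f -> spans e (f - a *: e).
Proof.
move=> ef v; have [k [l ->]] := ef v; exists (k + l * a), l.
by rewrite scalerBr scalerA scalerDl [l *: f - _]addrC addrA addrK.
Qed.

(** With [x] a unit vector on the line of [u] and [y] orthogonal to it, the pencil
    is spanned by [x (x) x] and [al x (x) y + be_ y (x) x + ga y (x) y]. If
    [ga = 0] this is one of the types 3 to 5. Otherwise [al = be_], and completing
    the square exhibits a second square in the pencil: type 1. *)
Lemma square_pencil E (u : E 1%N) (e : E 2%N) : e != 0 ->
  beta E 1 1 e = u \ox u -> exists T, has_pencil T E.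
Proof.
move=> e0 be.
have bI := isometric_inj (@beta_isometric C E 1 1 isT isT).
have d1 := @fiber_dim C E 1%N isT; have d2 := @fiber_dim C E 2%N isT.
have u0 : u != 0.
  apply: contra e0 => /eqP u0; apply/eqP/bI.
  by rewrite be u0 pure0r linear0.
have [c c0 xx] := unit_scale u0; set x := c *: u in xx.
have [y [yy xy]] := orthonormal_complete d1 xx.
have gr T : overlap T = 0 -> gram T x y by move=> T0; split; rewrite ?T0.
have fr : free [:: x; y] by apply: (@gram_free_overlap _ (Type4 C)); apply: gr.
have xyS := dim2_spans d1 fr.
pose e1 := (c * c) *: e.
have be1 : beta E 1 1 e1 = x \ox x by rewrite homZ be !pureE scalerA.
have e10 : e1 != 0 by rewrite scaler_eq0 mulf_eq0 orbb (negPf c0) (negPf e0).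
clearbody x e1.
have [f frf] := free_complete d2 e10.
have [w1 [w2 bf]] := tens_decomp xyS (beta E 1 1 f).
have [a [al w1E]] := xyS w1; have [be_ [ga w2E]] := xyS w2.
pose f1 := f - a *: e1.
have bf1 : beta E 1 1 f1 = al *: (x \ox y) + be_ *: (y \ox x) + ga *: (y \ox y).
  rewrite /f1 -scaleNr homD homZ bf be1 w1E w2E !pureE scaleNr.
  by rewrite addrC !addrA addNr add0r.
have f10 : f1 != 0.
  apply/eqP => H; have [_ /eqP] : - a = 0 /\ 1 = 0 :> C.
    by apply: (comb_coord frf); rewrite !scale0r addr0 scale1r addrC scaleNr -H.
  by rewrite oner_eq0.
have := beta_extendable xyS (spans_shift a (dim2_spans d2 frf)).
rewrite -/f1 be1 bf1 => /(extendable_square fr).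
have [ga0 _|ga0 [/eqP|alE]] := eqVneq ga 0; first last.
- (* Modulo [x (x) x], [ga (k x + y) (x) (k x + y)] is the second generator. *)
  pose k := al / ga.
  have fr' : free [:: x; k *: x + y].
    apply: free_of_indep => p q; rewrite scalerDr scalerA addrA -scalerDl => H.
    have [H1 q0] : p + q * k = 0 /\ q = 0.
      by apply: (comb_coord fr); rewrite H !scale0r addr0.
    by move: H1; rewrite q0 mul0r addr0.
  have [c1 [c2 [c10 c20 g1 g2 g12]]] := gram_scale fr'.
  exists (Type1 g12).
  apply: (@has_pencil_intro _ _ (c1 *: x) (c2 *: (k *: x + y)) ((c1 * c1) *: e1)
    ((c2 * c2 / ga) *: (f1 + (k * al) *: e1))) => //.
    by rewrite /gen1 homZ be1 !pureE scalerA.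
  rewrite /gen2 homZ homD homZ be1 bf1 -alE !pureE !scalerDr !scalerA /k.
  have -> : c2 * c2 / ga * al = c2 * c2 * (al / ga) by field.
  have -> : c2 * c2 / ga * ga = c2 * c2 by field.
  have -> : c2 * c2 / ga * (al / ga * al) = c2 * c2 * (al / ga) * (al / ga).
    by field.
  by rewrite addrC !addrA.
- by rewrite (negPf ga0).
have [be0|be0] := eqVneq be_ 0; last first.
  have [al0|al0] := eqVneq al 0.
    exists (Type4 C); apply: (@has_pencil_intro _ _ x y e1 (be_^-1 *: f1)).
    + exact: gr.
    + exact: be1.
    + by rewrite /gen2 homZ bf1 al0 ga0 !scale0r add0r addr0 scalerK.
  have l0 : al / be_ != 0 by rewrite mulf_neq0 ?invr_eq0.
  exists (Type3 l0); apply: (@has_pencil_intro _ _ x y e1 (be_^-1 *: f1)).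
  + exact: gr.
  + exact: be1.
  + rewrite /gen2 homZ bf1 ga0 !scale0r addr0 addrC scalerDr scalerK //.
    by rewrite scalerA mulrC.
have al0 : al != 0.
  apply: contra f10 => /eqP al0; apply/eqP/bI.
  by rewrite bf1 al0 be0 ga0 !scale0r !addr0 linear0.
exists (Type5 C); apply: (@has_pencil_intro _ _ x y e1 (al^-1 *: f1)).
+ exact: gr.
+ exact: be1.
+ by rewrite /gen2 homZ bf1 be0 ga0 !scale0r !addr0 scalerK.
Qed.

(** A pencil contains a rank one tensor [u (x) v]. If a square can be found,
    [square_pencil] applies; otherwise [u] and [v] are independent, and
    [extendable_swap] leaves only the pencil of [u (x) v] and [v (x) u]: type 2. *)
Lemma has_pencil_ex E : exists T, has_pencil T E.
Proof.
have bI := isometric_inj (@beta_isometric C E 1 1 isT isT).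
have d1 := @fiber_dim C E 1%N isT; have d2 := @fiber_dim C E 2%N isT.
have [x [y xy]] := free2_ex d1; have [e2 [e3 e23]] := free2_ex d2.
have [s [t [u [v [st uv]]]]] :=
  pencil_rank_one (beta E 1 1) e2 e3 (dim2_spans d1 xy).
set e := s *: e2 + t *: e3 in uv.
have e0 : e != 0.
  apply: contraL st => /eqP e0; rewrite negb_or !negbK.
  have [-> ->] : s = 0 /\ t = 0.
    by apply: (comb_coord e23); rewrite -/e e0 !scale0r addr0.
  by rewrite eqxx.
clearbody e.
have v0 : v != 0.
  by apply: contra e0 => /eqP v0; apply/eqP/bI; rewrite uv v0 pure0r linear0.
have [fr|] := boolP (free [:: u; v]); last first.
  rewrite free_cons span_seq1 seq1_free v0 andbT negbK => /vlineP[k uE].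
  have k0 : k != 0.
    apply: contra e0 => /eqP k0; apply/eqP/bI.
    by rewrite uv uE k0 scale0r -(scale0r u) pureZl scale0r linear0.
  apply: (@square_pencil E v (k^-1 *: e)).
    by rewrite scaler_eq0 invr_eq0 (negPf k0).
  by rewrite homZ uv uE pureZl scalerK.
have uvS := dim2_spans d1 fr.
have [f frf] := free_complete d2 e0.
have [w1 [w2 bf]] := tens_decomp uvS (beta E 1 1 f).
have [al [a w1E]] := uvS w1; have [be [ga w2E]] := uvS w2.
pose f1 := f - a *: e.
have bf1 : beta E 1 1 f1 = al *: (u \ox u) + be *: (v \ox u) + ga *: (v \ox v).
  rewrite /f1 -scaleNr homD homZ bf uv w1E w2E !pureE scaleNr.
  rewrite -!addrA; congr (_ + _).
  by rewrite addrC -!addrA addNr addr0.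
have f10 : f1 != 0.
  apply/eqP => H; have [_ /eqP] : - a = 0 /\ 1 = 0 :> C.
    by apply: (comb_coord frf); rewrite !scale0r addr0 scale1r addrC scaleNr -H.
  by rewrite oner_eq0.
have := beta_extendable uvS (spans_shift a (dim2_spans d2 frf)).
rewrite -/f1 uv bf1 => /(extendable_swap fr).
clearbody f1; case=> -[z1 z2]; rewrite z1 z2 !scale0r ?addr0 ?add0r in bf1.
- have be0 : be != 0.
    by apply: contra f10 => /eqP be0; apply/eqP/bI; rewrite bf1 be0 scale0r linear0.
  have [c1 [c2 [c10 c20 g1 g2 g12]]] := gram_scale fr.
  exists (Type2 g12).
  apply: (@has_pencil_intro _ _ (c1 *: u) (c2 *: v) ((c1 * c2) *: e)
    ((c1 * c2 / be) *: f1)) => //.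
    by rewrite /gen1 homZ uv !pureE scalerA.
  by rewrite /gen2 homZ bf1 !pureE !scalerA divfK // mulrC.
- have al0 : al != 0.
    by apply: contra f10 => /eqP al0; apply/eqP/bI; rewrite bf1 al0 scale0r linear0.
  apply: (@square_pencil E u (al^-1 *: f1)).
    by rewrite scaler_eq0 invr_eq0 (negPf al0).
  by rewrite homZ bf1 scalerK.
- have ga0 : ga != 0.
    by apply: contra f10 => /eqP ga0; apply/eqP/bI; rewrite bf1 ga0 scale0r linear0.
  apply: (@square_pencil E v (ga^-1 *: f1)).
    by rewrite scaler_eq0 invr_eq0 (negPf ga0).
  by rewrite homZ bf1 scalerK.
Qed.

End Existence.

Theorem theorem1p5 (R : realType) (E : subproduct_system R[i]) :
  exists! T : sps_type R[i], isomorphic E (calE T).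
Proof.
have [T pT] := has_pencil_ex E.
have [x [y bT]] := calE_basis T.
exists T; split; first exact: pencil_isomorphic bT pT.
move=> T' iT'; have [x' [y' bT']] := calE_basis T'.
exact: has_pencil_uniq pT (isomorphic_pencil bT' iT').
Qed.
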